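(* Let $\mathcal{A}$ be either of the Banach algebras $A$, $B$. Up to equivalence, the irreducible finite-dimensional right representations of $\mathcal{A}$ are given by: (i) the $1$-dimensional representations given by the multiplicative linear functionals $\chi$ determined by pairs $(\chi(x),\chi(y))$ of complex numbers with either $\chi(y)=1$ and $0<|\chi(x)|\le 1$, or $\chi(x)=0$ and $|\chi(y)|=1$; and (ii) the family $\pi_{\alpha,\gamma}$, where $\alpha\in\mathbb{T}$ satisfies $\alpha^{2^k}=\alpha$ for some $k\in\mathbb{N}$, and $\gamma\in\mathbb{C}$ satisfies $0<|\gamma|\le 1$. These representations separate the points of $\mathcal{A}$, i.e. for each non-zero $a\in\mathcal{A}$ at least one of them does not annihilate $a$.
   Context: $\mathbb{N}=\{1,2,3,\dots\}$ and $\mathbb{T}$ is the unit circle. $W$ denotes the Wiener algebra of continuous complex functions on $\mathbb{T}$ with absolutely convergent Fourier series; for $\phi\in W$, $\|\phi\|_1$ is the sum of the absolute values of its Fourier coefficients. $A$ is the Banach algebra of formal series $a=\sum_{m=0}^\infty x^m\phi_m$ (also written $\sum x^m\phi_m(y)$) with $\phi_m\in W$ and $\|a\|=\sum_m\|\phi_m\|_1<\infty$. $B$ is the Banach algebra of formal series $b=\sum_{m=0}^\infty x^m\phi_m$ with $\phi_m\in C(\mathbb{T})$ and $\|b\|=\sum_m\|\phi_m\|_\infty<\infty$. Here $y$ is identified with the function $\zeta\mapsto\zeta$, and in both algebras the product is determined by $(x^m\phi)(x^n\psi)=x^{m+n}\,\phi(\zeta^{2^n})\psi(\zeta)$; in particular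 $yx=xy^2$ and $y$ is invertible. A multiplicative linear functional $\chi$ is determined by $\chi(x),\chi(y)$ through $\chi(\sum x^m\phi_m)=\sum_m\chi(x)^m\phi_m(\chi(y))$. For $\alpha\in\mathbb{T}$ with $\alpha^{2^k}=\alpha$ for some $k\in\mathbb{N}$, take $k$ minimal. Let $X$ be the $k\times k$ matrix with $X_{1,k}=1$, $X_{i,i-1}=1$ for $2\le i\le k$ and all other entries $0$ (so $X=[1]$ if $k=1$), and let $Y$ be the diagonal matrix $\mathrm{diag}(\alpha,\alpha^2,\alpha^4,\dots,\alpha^{2^{k-1}})$. For $0<|\gamma|\le1$, $\pi_{\alpha,\gamma}$ is the right representation on $\mathbb{C}^k$ (matrices acting on row vectors from the right) under which $x$ and $y$ are mapped to $\gamma X$ and $Y$, so that $\sum x^m\phi_m(y)$ is mapped to $\sum_m\gamma^mX^m\phi_m(Y)$, with $\phi_m(Y)=\mathrm{diag}(\phi_m(\alpha),\phi_m(\alpha^2),\dots,\phi_m(\alpha^{2^{k-1}}))$. A right representation is irreducible if it is non-zero and has no invariant subspaces other than $(0)$ and the whole space. *)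

(* Defs.v *)
From HB Require Import structures.
From mathcomp Require Import all_boot all_order all_algebra.
From mathcomp Require Import all_classical all_reals all_analysis.
From mathcomp.real_closed Require Import complex.

Set Implicit Arguments.
Unset Strict Implicit.
Unset Printing Implicit Defensive.

Import Order.TTheory GRing.Theory Num.Theory.
Import numFieldNormedType.Exports.
Import ComplexField.

Local Open Scope classical_set_scope.
Local Open Scope ring_scope.
Local Open Scope complex_scope.

(* The library puts the topology of a numFieldType K on the alias K^o; this
   makes it available on R[i]. *)
HB.instance Definition _ (R : realType) := NormedModule.copy R[i] R[i]^o.

(* As a type, [circle R] carries the topology induced by R[i]. *)
Definition circle (R : realType) : set R[i] := [set z | `|z| = 1].
Arguments circle : clear implicits.

Section WienerAlgebra.
Variable R : realType.
Implicit Types (z : circle R) (phi : circle R -> R[i]).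

Lemma circle_expi (t : R) : circle R (cos t +i* sin t).
Proof. by rewrite /circle /= normc_def /= cos2Dsin2 sqrtr1. Qed.

Lemma circle_pow z (n : nat) : circle R (\val z ^+ n).
Proof.
have /set_mem z1 := valP z.
by rewrite /circle /= normrX z1 expr1n.
Qed.

Definition expi (t : R) : circle R :=
  exist (fun w => w \in circle R) _ (mem_set (circle_expi t)).

Definition cpow z (n : nat) : circle R :=
  exist (fun w => w \in circle R) _ (mem_set (circle_pow z n)).

Definition fourier phi (n : int) : R[i] :=
  let f t := phi (expi t) * \val (expi t) ^ (- n) in
  ((2 * pi)^-1)%:C *
  ((\int[lebesgue_measure]_(t in `[0, 2 * pi]) complex.Re (f t)) +i*
   (\int[lebesgue_measure]_(t in `[0, 2 * pi]) complex.Im (f t))).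

Definition wiener_norm phi : \bar R :=
  \esum_(n in [set: int]) (Normc.normc (fourier phi n))%:E.

Definition wiener phi : Prop :=
  continuous phi /\ (wiener_norm phi < +oo)%E.

Definition sup_norm phi : \bar R :=
  ereal_sup [set (Normc.normc (phi z))%:E | z in [set: circle R]].

End WienerAlgebra.

(* [a : fseries R] stands for the formal series \sum_m x^m (a m). *)
Definition fseries (R : realType) : Type := nat -> circle R -> R[i].
HB.instance Definition _ (R : realType) :=
  GRing.Lmodule.copy (fseries R) (nat -> circle R -> R[i]).

Section FormalSeries.
Variable R : realType.
Implicit Types (a b : fseries R) (z : circle R).

Definition algA : set (fseries R) :=
  [set a | (forall m, wiener (a m)) /\
           (\sum_(m <oo) wiener_norm (a m) < +oo)%E].

Definition algB : set (fseries R) :=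
  [set a | (forall m, continuous (a m)) /\
           (\sum_(m <oo) sup_norm (a m) < +oo)%E].

(* Coefficient of x^p in the product, the bilinear extension of
   (x^m phi)(x^n psi) = x^(m + n) phi(z^(2^n)) psi(z). *)
Definition smul a b : fseries R := fun p z =>
  \sum_(m < p.+1) a m (cpow z (2 ^ (p - m))) * b (p - m)%N z.

Definition monomial (m : nat) (phi : circle R -> R[i]) : fseries R :=
  fun p z => if p == m then phi z else 0.

Definition gen_x : fseries R := monomial 1 (fun=> 1).
Definition gen_y : fseries R := monomial 0 (fun z => \val z).

Lemma smul_monomial m n phi psi :
  smul (monomial m phi) (monomial n psi) =
  monomial (m + n) (fun z => phi (cpow z (2 ^ n)) * psi z).
Proof.
apply/funext => p; apply/funext => z; rewrite /smul /monomial.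
have [->|pmn] := eqVneq p (m + n)%N.
  have mP : (m < (m + n).+1)%N by rewrite ltnS leq_addr.
  rewrite (bigD1 (Ordinal mP)) //= eqxx addKn eqxx big1 ?addr0 // => i im.
  by rewrite (_ : (i == m :> nat) = false) ?mul0r //; apply/negbTE.
rewrite big1 // => i _; case: eqP => [im|]; last by rewrite mul0r.
case: eqP => [pin|]; last by rewrite mulr0.
by case/eqP: pmn; rewrite -pin -im subnKC // -ltnS.
Qed.

End FormalSeries.
Arguments algA : clear implicits.
Arguments algB : clear implicits.
Arguments gen_x : clear implicits.
Arguments gen_y : clear implicits.

Section Representations.
Variables (R : realType) (AA : set (fseries R)).

(* Matrices act on row vectors from the right, so a right representation is
   an algebra morphism into matrices.  The map is only constrained on [AA]. *)
Definition right_rep n (rho : fseries R -> 'M[R[i]]_n) : Prop :=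
  [/\ forall a b, AA a -> AA b -> rho (a + b) = rho a + rho b,
      forall (c : R[i]) a, AA a -> rho (c *: a) = c *: rho a &
      forall a b, AA a -> AA b -> rho (smul a b) = rho a *m rho b].

(* The row space of U is the subspace tested for invariance. *)
Definition irreducible_rep n (rho : fseries R -> 'M[R[i]]_n) : Prop :=
  [/\ right_rep rho,
      exists2 a, AA a & rho a <> 0 &
      forall U : 'M[R[i]]_n, (forall a, AA a -> stablemx U (rho a)) ->
        U = 0 \/ row_full U].

Definition equivalent_rep n (rho rho' : fseries R -> 'M[R[i]]_n) : Prop :=
  exists2 P : 'M[R[i]]_n,
    P \in unitmx & forall a, AA a -> P *m rho a = rho' a *m P.

End Representations.

Section ListedRepresentations.
Variable R : realType.
Implicit Types (a : fseries R) (p gamma : R[i]) (q alpha : circle R).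

Definition chi p q a : R[i] := limn (series (fun m => p ^+ m * a m q)).

Definition shift_mx k : 'M[R[i]]_k :=
  \matrix_(i, j) ((i == 0 :> nat) && (j == k.-1 :> nat)
                  || (i == j.+1 :> nat))%:R.

Definition diag_of k alpha (phi : circle R -> R[i]) : 'M[R[i]]_k :=
  diag_mx (\row_i phi (cpow alpha (2 ^ i))).

Definition pi_rep k alpha gamma a : 'M[R[i]]_k :=
  \matrix_(i, j) limn (series (fun m =>
    (gamma ^+ m *: (shift_mx k ^+ m *m diag_of k alpha (a m))) i j)).

Definition least_period (k : nat) alpha : Prop :=
  [/\ (0 < k)%N, cpow alpha (2 ^ k) = alpha &
      forall j, (0 < j < k)%N -> cpow alpha (2 ^ j) <> alpha].

(* That |q| = 1 is part of the type of q. *)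
Inductive listed_rep : forall n, (fseries R -> 'M[R[i]]_n) -> Prop :=
| listed_chi p q of (\val q = 1 /\ 0 < `|p| <= 1) \/ p = 0 :
    listed_rep (fun a => (chi p q a)%:M : 'M[R[i]]_1)
| listed_pi k alpha gamma of least_period k alpha & 0 < `|gamma| <= 1 :
    listed_rep (@pi_rep k alpha gamma).

Lemma limn_series1 (u : nat -> R[i]) m :
  (forall i, i != m -> u i = 0) -> limn (series u) = u m.
Proof.
move=> um; apply/cvg_lim => //; apply: cvg_near_cst.
exists m.+1 => //= N /= mN; rewrite /series /= big_mkord.
by rewrite (bigD1 (Ordinal mN)) //= big1 ?addr0 // => i im; exact: um.
Qed.

Lemma chi_monomial p q m phi : chi p q (monomial m phi) = p ^+ m * phi q.
Proof.
rewrite /chi (@limn_series1 _ m) /monomial ?eqxx // => i /negbTE ->.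
by rewrite mulr0.
Qed.

Lemma pi_rep_monomial k alpha gamma m phi :
  pi_rep k alpha gamma (monomial m phi) =
  gamma ^+ m *: (shift_mx k ^+ m *m diag_of k alpha phi).
Proof.
apply/matrixP => i j; rewrite mxE (@limn_series1 _ m).
  by rewrite /monomial eqxx.
move=> l /negbTE lm; rewrite /monomial lm /diag_of.
rewrite (_ : \row__ _ = 0) ?linear0 ?mulmx0 ?scaler0 ?mxE //.
by apply/rowP => h; rewrite !mxE.
Qed.

Lemma chi_x p q : chi p q (gen_x R) = p.
Proof. by rewrite chi_monomial expr1 mulr1. Qed.

Lemma chi_y p q : chi p q (gen_y R) = \val q.
Proof. by rewrite chi_monomial expr0 mul1r. Qed.

Lemma pi_rep_x k alpha gamma :
  pi_rep k alpha gamma (gen_x R) = gamma *: shift_mx k.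
Proof.
rewrite pi_rep_monomial !expr1 /diag_of (_ : \row__ _ = const_mx 1).
  by rewrite diag_const_mx mulmx1.
by apply/rowP => h; rewrite !mxE.
Qed.

Lemma pi_rep_y k alpha gamma :
  pi_rep k alpha gamma (gen_y R) =
  diag_mx (\row_(i < k) \val alpha ^+ (2 ^ i)).
Proof. by rewrite pi_rep_monomial !expr0 scale1r mul1mx. Qed.

End ListedRepresentations.

(* Main.v *)
Require Import Defs.
From mathcomp Require Import all_boot all_order all_algebra.
From mathcomp Require Import all_classical all_reals all_analysis.
From mathcomp.real_closed Require Import complex.
From mathcomp Require Import ring lra zify.

(** The two algebras are treated together.  A coefficient algebra (the Wiener
    algebra or C(T)) is described by a relation nb phi c, meaning that phi has
    norm at most c, subject to the axioms of coef_norm; the algebra of series is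
    then nb_alg nb.  For C(T) the axioms are immediate.  For the Wiener algebra
    they rest on the domination of the values by the norm, which follows from
    Fejer's theorem (fejer_cvg, wiener_bound_ev), and on completeness
    (wiener_bound_sums); Fourier inversion and submultiplicativity of the norm
    follow.  In both cases the bounded characters sending z to a point q of the
    circle are the evaluations at q (sup_bound_char, wiener_bound_char).

    The listed representations are irreducible.  The series defining pi_rep
    converge absolutely and give a morphism (piM), by density of the polynomials
    in x.  The points alpha^(2^i), i < k, being distinct, interpolation gives
    coefficients acting as the matrix units on the diagonal, and x permutes the
    basis vectors cyclically up to nonzero scalars (pi_irreducible).

    They are the only ones.  Let rho be irreducible; it is not assumed to be
    continuous, but an element of norm less than 1 fixes no nonzero vector
    (neumann_fixed), by the Neumann series.  The commutative coefficient algebra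
    has a common eigenvector, on which it acts through a bounded character, thus
    by evaluation at some q (joint_eigen_exists).  The relation
    phi x = x phi(z^2) shows that the kernel of x is invariant, so x acts as 0 or
    invertibly (rho_x_dichotomy).  In the first case the line spanned by the
    eigenvector is invariant, and rho is a character with chi(x) = 0.  In the
    second case the inverse of x sends joint eigenvectors for q to joint
    eigenvectors for q^2; as there are finitely many joint eigenvalues, some
    alpha among them is periodic under squaring.  A vector u of the joint
    eigenspace of alpha that is an eigenvector of x^k spans with its images
    under x a copy of the space of pi_rep k alpha gamma, at least as far as the
    polynomials in x are concerned.  The extension to all series is an
    automatic continuity argument, again based on neumann_fixed
    (classification_unit).

    They separate points.  If every pi_rep k alpha gamma kills a, the entries of
    these matrices are power series in gamma that vanish identically on the
    punctured disc, so that all coefficients of a vanish at alpha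
    (power_series_zero); the periodic points being dense (periodic_dense),
    a = 0. *)

Set Implicit Arguments.
Unset Strict Implicit.
Unset Printing Implicit Defensive.

Import Order.TTheory GRing.Theory Num.Theory.
Import numFieldNormedType.Exports.
Import ComplexField.

Local Open Scope classical_set_scope.
Local Open Scope ring_scope.
Local Open Scope complex_scope.

(** * Modulus, convergence and continuity over the complex numbers *)

Section ModulusFacts.
Variable R : realType.
Implicit Types x y : R[i].
Local Notation nc := (@Normc.normc R).

Lemma normc_norm x : `|x| = (nc x)%:C.
Proof. by []. Qed.

Lemma normc_ge0 x : 0 <= nc x.
Proof. by case: x => a b; rewrite sqrtr_ge0. Qed.

Lemma normcD x y : nc (x + y) <= nc x + nc y.
Proof. exact: le_normcD. Qed.

Lemma normcNE x : nc (- x) = nc x.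
Proof. exact: normcN. Qed.

Lemma normc_distC x y : nc (x - y) = nc (y - x).
Proof. by rewrite -normcNE opprB. Qed.

Lemma normc_dist x y : `|nc x - nc y| <= nc (x - y).
Proof.
rewrite ler_norml lerNl opprB !lerBlDr; apply/andP; split.
  by rewrite normc_distC; apply: le_trans (normcD _ _); rewrite subrK.
by apply: le_trans (normcD _ _); rewrite subrK.
Qed.

Lemma normc_sum I (r : seq I) P (F : I -> R[i]) :
  nc (\sum_(i <- r | P i) F i) <= \sum_(i <- r | P i) nc (F i).
Proof.
elim/big_rec2: _ => [|i a b _ le]; first by rewrite Normc.normc0.
by apply: le_trans (normcD _ _) _; rewrite lerD2l.
Qed.

Lemma normcX x n : nc (x ^+ n) = nc x ^+ n.
Proof.
by elim: n => [|n IH]; rewrite ?expr0 ?Normc.normc1 // !exprS Normc.normcM IH.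
Qed.

Lemma normc_real (r : R) : nc r%:C = `|r|.
Proof. by rewrite /= expr0n addr0 sqrtr_sqr. Qed.

Lemma Re_le_normc x : `|complex.Re x| <= nc x.
Proof.
case: x => a b /=; rewrite -sqrtr_sqr ler_wsqrtr // lerDl sqr_ge0 //.
Qed.

Lemma Im_le_normc x : `|complex.Im x| <= nc x.
Proof.
case: x => a b /=; rewrite -(sqrtr_sqr b) ler_wsqrtr // lerDr sqr_ge0 //.
Qed.

Lemma normc_le_ReIm x : nc x <= `|complex.Re x| + `|complex.Im x|.
Proof.
case: x => a b /=; rewrite -[leRHS]ger0_norm ?addr_ge0 // -sqrtr_sqr.
rewrite ler_wsqrtr // sqrrD !real_normK ?num_real // addrAC.
by rewrite lerDl mulrn_wge0 // mulr_ge0.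
Qed.

Lemma normc_circle (z : circle R) : nc (\val z) = 1.
Proof. by case: z => z /= /set_mem [] ->. Qed.

Lemma normc_circle_exprz (q : circle R) (n : int) : nc (\val q ^ n) = 1.
Proof.
case: n => k; first by rewrite normcX normc_circle expr1n.
by rewrite NegzE /exprz Normc.normcV normcX normc_circle expr1n invr1.
Qed.

Lemma mulc_conj (x : R[i]) : x * conjc x = (nc x ^+ 2)%:C.
Proof.
case: x => a b; rewrite /= sqr_sqrtr ?addr_ge0 ?sqr_ge0 //.
apply/eqP; rewrite eq_complex /= mulrN opprK -!expr2 eqxx /=.
by rewrite mulrC addrC mulNr addrN.
Qed.

Lemma val_circle_neq0 (z : circle R) : \val z != 0.
Proof. by apply/eqP => z0; have /eqP := normc_circle z; rewrite z0 Normc.normc0 eq_sym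
  oner_eq0. Qed.

Lemma circle_inj (z w : circle R) : \val z = \val w -> z = w.
Proof. exact: val_inj. Qed.

Lemma normc_lt_norm x (e : R) : (nc x < e) = (`|x| < e%:C).
Proof. by rewrite normc_norm ltcR. Qed.

Lemma pos_complexP (e : R[i]) : 0 < e -> exists2 r : R, 0 < r & e = r%:C.
Proof. 
by case: e => a b; rewrite ltcE /= => /andP[/eqP -> a0]; exists a. Qed.

Lemma cvg_normcP (u : nat -> R[i]) l :
  u @ \oo --> l <->
  forall e : R, 0 < e -> exists N, forall n, (N <= n)%N -> nc (u n - l) < e.
Proof.
split=> [/cvgrPdist_lt ul e e0 | ul].
  have e0' : 0 < e%:C :> R[i] by rewrite ltcR.
  have [N _ NP] := ul _ e0'.
  exists N => n Nn; rewrite normc_lt_norm distrC.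
  exact: NP.
apply/cvgrPdist_lt => _ /pos_complexP[e e0 ->].
have [N NP] := ul _ e0; exists N => // n /= Nn.
by rewrite distrC -normc_lt_norm NP.
Qed.

(** Continuity on the circle in epsilon-delta form, with real radii and the
    real-valued modulus. *)
Definition ccontinuous (phi : circle R -> R[i]) : Prop :=
  forall q, forall e : R, 0 < e -> exists2 d : R, 0 < d &
    forall z, nc (\val z - \val q) < d -> nc (phi z - phi q) < e.

Lemma ccontinuousP (phi : circle R -> R[i]) :
  continuous phi <-> ccontinuous phi.
Proof.
split=> [cphi q e e0|h q].
  have /cvgrPdist_lt/(_ e%:C) := cphi q.
  rewrite ltcR => /(_ e0).
  case=> U [[V oV VU] Uq UP].
  have : nbhs (\val q) V by apply: open_nbhs_nbhs; split => //; rewrite -VU in Uq.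
  move/nbhs_ballP => [_ /= /pos_complexP[d d0 ->] dV].
  exists d => // z zq; rewrite normc_lt_norm distrC; apply: UP.
  by rewrite -VU; apply: dV; rewrite /ball /= distrC -normc_lt_norm.
move=> U /nbhs_ballP[_ /= /pos_complexP[e e0 ->] eU].
have [d d0 dP] := h q _ e0.
have bq : nbhs (\val q) (ball (\val q) d%:C) by apply: nbhsx_ballx; rewrite ltcR.
have := @initial_continuous _ _ (@set_val _ (circle R)) q _ bq.
case=> V [oV Vq VB]; exists V; split => // z /VB /=.
rewrite /ball /= => zq; apply: eU.
by rewrite /ball /= distrC -normc_lt_norm dP // normc_lt_norm distrC.
Qed.
End ModulusFacts.

(** * Absolutely convergent series of complex numbers *)

Section Series.
Variable R : realType.
Local Notation nc := (@Normc.normc R).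

(** The series with general term u converges to l. *)
Definition sums (u : nat -> R[i]) (l : R[i]) : Prop :=
  (series u : nat -> R[i]) @ \oo --> l.

Lemma sumsP u l : sums u l <->
  forall e : R, 0 < e ->
    exists N, forall n, (N <= n)%N -> nc (\sum_(k < n) u k - l) < e.
Proof.
have E n : series u n = \sum_(k < n) u k by rewrite seriesEnat /= big_mkord.
split=> [/cvg_normcP ul e /ul[N NP]|ul].
  by exists N => n /NP; rewrite E.
by apply/cvg_normcP => e /ul[N NP]; exists N => n /NP; rewrite E.
Qed.

(** A nonnegative series with bounded partial sums has small tails. *)
Lemma bounded_tail (c : nat -> R) M :
  (forall k, 0 <= c k) -> (forall N, \sum_(k < N) c k <= M) ->
  forall e, 0 < e -> exists N, forall n, \sum_(k < n) c (N + k)%N < e.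
Proof.
move=> c0 cM e e0.
pose S := range (fun N => \sum_(k < N) c k).
have hS : has_sup S.
  by split; [exists 0, 0%N => //; rewrite big_ord0 | exists M => _ [N _ <-]].
have [_ [N _ <-] SN] := sup_adherent e0 hS.
exists N => n; rewrite -(ltrD2l (\sum_(k < N) c k)).
have -> : \sum_(k < N) c k + \sum_(k < n) c (N + k)%N = \sum_(k < N + n) c k.
  by rewrite big_split_ord.
rewrite -ltrBlDr; apply: le_lt_trans SN.
by rewrite lerD2r; apply: (ub_le_sup hS.2); exists (N + n)%N.
Qed.

Lemma abs_sums (u : nat -> R[i]) M :
  (forall N, \sum_(k < N) nc (u k) <= M) -> exists l, sums u l.
Proof.
move=> uM.
have cvgpart (f : R[i] -> R) : (forall x, `|f x| <= nc x) ->
    (exists l : R, forall e, 0 < e -> exists N, forall n, (N <= n)%N ->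
       `|\sum_(k < n) f (u k) - l| < e).
  move=> fn; have : cvgn (series (fun k => `|f (u k)|)).
    apply: nondecreasing_is_cvgn.
      apply/nondecreasing_seqP => n; rewrite !seriesEnat /= !big_mkord.
      by rewrite big_ord_recr /= lerDl.
    exists M => _ [n _ <-]; apply: le_trans (uM n).
    by rewrite seriesEnat /= big_mkord; apply: ler_sum => i _; exact: fn.
  move=> /normed_cvg/cvg_ex[l /cvgrPdist_lt lP]; exists l => e /lP[N _ NP].
  exists N => n Nn; have := NP n Nn.
  by rewrite seriesEnat /= big_mkord distrC.
have [a aP] := cvgpart _ (@Re_le_normc R).
have [b bP] := cvgpart _ (@Im_le_normc R).
exists (a +i* b); apply/sumsP => e e0.
have e20 : 0 < e / 2 by rewrite divr_gt0.
have [N1 N1P] := aP _ e20; have [N2 N2P] := bP _ e20.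
exists (maxn N1 N2) => n; rewrite geq_max => /andP[h1 h2].
apply: le_lt_trans (normc_le_ReIm _) _.
rewrite (splitr e) !raddfB /= !raddf_sum /=.
apply: ltrD; [exact: N1P | exact: N2P].
Qed.

Lemma sums_normc_le (u : nat -> R[i]) l M :
  (forall N, \sum_(k < N) nc (u k) <= M) -> sums u l -> nc l <= M.
Proof.
move=> uM /sumsP ul; apply/ler_addgt0Pr => e /ul[N NP].
have := NP _ (leqnn N); rewrite normc_distC => h.
rewrite -(subrK (\sum_(k < N) u k) l) addrC; apply: le_trans (normcD _ _) _.
apply: lerD (ltW h); apply: le_trans (uM N); exact: normc_sum.
Qed.

Lemma sums_unique (u : nat -> R[i]) l l' : sums u l -> sums u l' -> l = l'.
Proof. by move=> h h'; rewrite -(cvg_lim _ h) // (cvg_lim _ h'). Qed.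

Lemma sums_limn (u : nat -> R[i]) l : sums u l -> limn (series u) = l.
Proof. by move/cvg_lim; apply. Qed.

Lemma sumsD (u v : nat -> R[i]) l m :
  sums u l -> sums v m -> sums (fun k => u k + v k) (l + m).
Proof.
move=> /sumsP ul /sumsP vm; apply/sumsP => e e0.
have e20 : 0 < e / 2 by rewrite divr_gt0.
have [N1 N1P] := ul _ e20; have [N2 N2P] := vm _ e20.
exists (maxn N1 N2) => n; rewrite geq_max => /andP[h1 h2].
rewrite big_split /= opprD addrACA; apply: le_lt_trans (normcD _ _) _.
by rewrite (splitr e); apply: ltrD; [exact: N1P | exact: N2P].
Qed.

Lemma sumsZ (c : R[i]) (u : nat -> R[i]) l :
  sums u l -> sums (fun k => c * u k) (c * l).
Proof.
move=> ul; rewrite /sums (_ : series _ = (fun n => c *: series u n)).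
  exact: cvgZr.
by apply/funext => n; rewrite !seriesEnat /= -mulr_sumr.
Qed.

Lemma sums_finite (u : nat -> R[i]) P :
  (forall k, (P <= k)%N -> u k = 0) -> sums u (\sum_(k < P) u k).
Proof.
move=> u0; apply/sumsP => e e0; exists P => n Pn.
rewrite -[n](subnKC Pn) big_split_ord /= addrAC subrr add0r.
by rewrite big1 ?Normc.normc0 // => i _; rewrite u0 ?leq_addr.
Qed.

Lemma sums0 : sums (fun=> 0) 0.
Proof. by have := @sums_finite (fun=> 0) 0 (fun _ _ => erefl); rewrite big_ord0. Qed.

Lemma sums_sum (I : eqType) (r : seq I) (P : pred I) (u : I -> nat -> R[i])
    (l : I -> R[i]) :
  (forall i, i \in r -> P i -> sums (u i) (l i)) ->
  sums (fun k => \sum_(i <- r | P i) u i k) (\sum_(i <- r | P i) l i).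
Proof.
elim: r => [|a r IH] h.
  rewrite big_nil (_ : (fun k => _) = fun=> 0); first exact: sums0.
  by apply/funext => k; rewrite big_nil.
have {}IH : sums (fun k => \sum_(i <- r | P i) u i k) (\sum_(i <- r | P i) l i).
  by apply: IH => i ir; apply: h; rewrite inE ir orbT.
rewrite big_cons; case: ifPn => Pa; last first.
  rewrite (_ : (fun k => _) = fun k => \sum_(i <- r | P i) u i k) //.
  by apply/funext => k; rewrite big_cons (negbTE Pa).
rewrite (_ : (fun k => _) = fun k => u a k + \sum_(i <- r | P i) u i k).
  by apply: sumsD IH; apply: h => //; rewrite mem_head.
by apply/funext => k; rewrite big_cons Pa.
Qed.

(** The remainder of a convergent series after N terms. *)
Lemma sums_shift (u : nat -> R[i]) l N :
  sums u l -> sums (fun k => u (N + k)%N) (l - \sum_(k < N) u k).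
Proof.
move=> /sumsP ul; apply/sumsP => e /ul[K KP].
exists K => n Kn; have := KP (N + n)%N (leq_trans Kn (leq_addl _ _)).
by rewrite big_split_ord /= opprB addrA [X in nc (X - _) < _ -> _]addrC.
Qed.

End Series.
Arguments sumsZ [R] c [u l] _.
Arguments sums_shift [R u l] N _.

(** * Continuous functions on the circle *)

Section Cont.
Variable R : realType.
Local Notation nc := (@Normc.normc R).
Implicit Types phi psi : circle R -> R[i].

Lemma ccontinuousD phi psi :
  ccontinuous phi -> ccontinuous psi -> ccontinuous (fun z => phi z + psi z).
Proof.
move=> cf cg q e e0.
have e20 : 0 < e / 2 by rewrite divr_gt0.
have [d1 d10 h1] := cf q _ e20; have [d2 d20 h2] := cg q _ e20.
exists (Num.min d1 d2) => [|z]; rewrite lt_min ?d10 // => /andP[z1 z2].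
rewrite opprD addrACA; apply: le_lt_trans (normcD _ _) _.
by rewrite (splitr e); apply: ltrD; [exact: h1 | exact: h2].
Qed.

Lemma ccontinuousM phi psi :
  ccontinuous phi -> ccontinuous psi -> ccontinuous (fun z => phi z * psi z).
Proof.
move=> cf cg q e e0.
set A := nc (phi q) + 1; set B := nc (psi q) + 1.
have A0 : 0 < A by rewrite ltr_wpDl ?normc_ge0.
have B0 : 0 < B by rewrite ltr_wpDl ?normc_ge0.
have eA : 0 < e / 2 / A by rewrite !divr_gt0.
have eB : 0 < e / 2 / B by rewrite !divr_gt0.
have [d1 d10 h1] := cf q _ eB; have [d2 d20 h2] := cg q _ eA.
have [d3 d30 h3] := cf q _ ltr01.
exists (Num.min d1 (Num.min d2 d3)) => [|z]; rewrite !lt_min ?d10 ?d20 //.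
move=> /and3P[/h1 z1 /h2 z2 /h3 z3].
have -> : phi z * psi z - phi q * psi q =
  phi z * (psi z - psi q) + psi q * (phi z - phi q) by ring.
apply: le_lt_trans (normcD _ _) _; rewrite !Normc.normcM (splitr e).
have phz : nc (phi z) <= A.
  rewrite -(subrK (phi q) (phi z)) addrC; apply: le_trans (normcD _ _) _.
  by rewrite lerD2l ltW.
apply: ltr_leD.
  apply: (@le_lt_trans _ _ (A * nc (psi z - psi q))).
    by rewrite ler_wpM2r ?normc_ge0.
  by rewrite mulrC -ltr_pdivlMr.
apply: (@le_trans _ _ (B * nc (phi z - phi q))).
  by rewrite ler_wpM2r ?normc_ge0 // lerDl.
by rewrite mulrC -ler_pdivlMr // ltW.
Qed.

Lemma ccontinuous_cst (c : R[i]) : ccontinuous (fun _ : circle R => c).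
Proof.
by move=> q e e0; exists 1 => // z _; rewrite subrr Normc.normc0.
Qed.

Lemma ccontinuous_ext phi psi :
  (forall z, phi z = psi z) -> ccontinuous phi -> ccontinuous psi.
Proof. by move/funext ->. Qed.

Lemma ccontinuousZ (c : R[i]) phi :
  ccontinuous phi -> ccontinuous (fun z => c * phi z).
Proof. by move=> h; exact: (ccontinuousM (ccontinuous_cst c) h). Qed.

Lemma ccontinuous_sum I (r : seq I) (P : pred I) (F : I -> circle R -> R[i]) :
  (forall i, P i -> ccontinuous (F i)) ->
  ccontinuous (fun z => \sum_(i <- r | P i) F i z).
Proof.
move=> h; elim: r => [|a r IH].
  apply: (@ccontinuous_ext (fun=> 0)); last exact: ccontinuous_cst.
  by move=> z; rewrite big_nil.
case Pa: (P a).
  apply: (@ccontinuous_ext (fun z => F a z + \sum_(i <- r | P i) F i z)).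
    by move=> z; rewrite big_cons Pa.
  exact: (ccontinuousD (h a Pa) IH).
apply: ccontinuous_ext IH => z; by rewrite big_cons Pa.
Qed.

Lemma ccontinuous_exprz (n : int) : ccontinuous (fun z : circle R => \val z ^ n).
Proof.
have cX (f : circle R -> R[i]) (k : nat) : ccontinuous f -> ccontinuous (fun z => f z ^+ k).
  move=> cf; elim: k => [|k IH].
    by apply: (@ccontinuous_ext (fun=> 1)) => //; exact: ccontinuous_cst.
  apply: (@ccontinuous_ext (fun z => f z * f z ^+ k)); first by move=> z; rewrite exprS.
  exact: ccontinuousM.
case: n => k.
  apply: cX; move=> q e e0; by exists e.
apply: (@ccontinuous_ext (fun z => (\val z)^-1 ^+ k.+1)).
  by move=> z; rewrite NegzE exprVn.
apply: cX; move=> q e e0; exists e => // z.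
have -> : (\val z)^-1 - (\val q)^-1 = (\val q - \val z) * (\val z)^-1 * (\val q)^-1.
  by field; rewrite !val_circle_neq0.
by rewrite !Normc.normcM !Normc.normcV !normc_circle !invr1 !mulr1 normc_distC.
Qed.

Lemma ccontinuous_cpow phi n :
  ccontinuous phi -> ccontinuous (fun z => phi (cpow z n)).
Proof.
move=> cf q e e0.
have [d d0 h] := cf (cpow q n) _ e0.
have /(_ q _ d0)[d' d'0 h'] := ccontinuous_exprz n.
by exists d' => // z /h' zq; apply: h.
Qed.

Lemma val_expi (t : R) : \val (expi t) = cos t +i* sin t.
Proof. by []. Qed.

(** Used for the real and the imaginary part, which are 1-Lipschitz. *)
Lemma continuous_along_expi (f : circle R -> R[i]) (g : R[i] -> R) :
  (forall x y, `|g x - g y| <= nc (x - y)) ->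
  ccontinuous f -> continuous (fun t : R => g (f (expi t)) : R).
Proof.
move=> gl cf t; apply/cvgrPdist_lt => e e0.
have [d d0 h] := cf (expi t) _ e0.
have d20 : 0 < d / 2 by rewrite divr_gt0.
have /cvgrPdist_lt/(_ _ d20) hc := @continuous_cos R t.
have /cvgrPdist_lt/(_ _ d20) hs := @continuous_sin R t.
near=> s; rewrite distrC; apply: le_lt_trans (gl _ _) _; apply: h.
apply: le_lt_trans (normc_le_ReIm _) _; rewrite !val_expi /= (splitr d).
rewrite distrC [X in _ + X]distrC.
by apply: ltrD; near: s.
Unshelve. all: by end_near. Qed.

Lemma continuous_Re_expi f : ccontinuous f ->
  continuous (fun t : R => complex.Re (f (expi t)) : R).
Proof. by apply: continuous_along_expi => x y; rewrite -raddfB Re_le_normc. Qed.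

Lemma continuous_Im_expi f : ccontinuous f ->
  continuous (fun t : R => complex.Im (f (expi t)) : R).
Proof. by apply: continuous_along_expi => x y; rewrite -raddfB Im_le_normc. Qed.

End Cont.

(** * The normalized integral over the circle *)

Section Mean.
Variable R : realType.
Local Notation nc := (@Normc.normc R).
Local Notation mu := (@lebesgue_measure R).
Local Notation I2pi := (`[0, 2 * pi]%classic : set R).
Implicit Types f g : circle R -> R[i].

(** The integral of f against the normalized Lebesgue measure of the circle. *)
Definition mean (f : circle R -> R[i]) : R[i] :=
  ((2 * pi)^-1)%:C *
  ((\int[mu]_(t in I2pi) complex.Re (f (expi t))) +i*
   (\int[mu]_(t in I2pi) complex.Im (f (expi t)))).

Lemma fourier_mean (phi : circle R -> R[i]) n :
  fourier phi n = mean (fun z => phi z * \val z ^ (- n)).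
Proof. by []. Qed.

Lemma twopi_gt0 : 0 < 2 * pi :> R.
Proof. by rewrite mulr_gt0 // pi_gt0. Qed.

Lemma continuous_integrable (h : R -> R) :
  continuous h -> mu.-integrable I2pi (EFin \o h).
Proof.
move=> ch; apply: continuous_compact_integrable; first exact: segment_compact.
exact: continuous_subspaceT.
Qed.

Lemma Rintegral_lin (h k : R -> R) a b : continuous h -> continuous k ->
  \int[mu]_(t in I2pi) (a * h t + b * k t) =
  a * \int[mu]_(t in I2pi) h t + b * \int[mu]_(t in I2pi) k t.
Proof.
move=> /continuous_integrable ch /continuous_integrable ck.
have ia : mu.-integrable I2pi (EFin \o (fun t => a * h t)).
  by apply: (integrableZl _ a ch); exact: measurable_itv.
have ib : mu.-integrable I2pi (EFin \o (fun t => b * k t)).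
  by apply: (integrableZl _ b ck); exact: measurable_itv.
by rewrite (RintegralD _ ia ib) ?(RintegralZl _ _ ch) ?(RintegralZl _ _ ck) //; exact:
  measurable_itv.
Qed.

Lemma meanD f g : ccontinuous f -> ccontinuous g ->
  mean (fun z => f z + g z) = mean f + mean g.
Proof.
move=> cf cg; rewrite /mean -mulrDr; congr (_ * _).
have cRf := continuous_Re_expi cf; have cIf := continuous_Im_expi cf.
have cRg := continuous_Re_expi cg; have cIg := continuous_Im_expi cg.
rewrite [RHS]/GRing.add /=; congr (_ +i* _).
  rewrite -[X in X + _]mul1r -[X in _ + X]mul1r -Rintegral_lin //.
  by apply: eq_Rintegral => t _; rewrite raddfD /= !mul1r.
rewrite -[X in X + _]mul1r -[X in _ + X]mul1r -Rintegral_lin //.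
by apply: eq_Rintegral => t _; rewrite raddfD /= !mul1r.
Qed.

Lemma meanZ (c : R[i]) f : ccontinuous f -> mean (fun z => c * f z) = c * mean f.
Proof.
move=> cf; rewrite /mean mulrCA; congr (_ * _).
case: c => a b.
rewrite [RHS]/GRing.mul /=.
have cR := continuous_Re_expi cf; have cI := continuous_Im_expi cf.
congr (_ +i* _).
  rewrite -mulNr -Rintegral_lin //.
  by apply: eq_Rintegral => t _; case: (f _) => x y /=; rewrite mulNr.
rewrite -Rintegral_lin //.
by apply: eq_Rintegral => t _; case: (f _) => x y /=; rewrite addrC.
Qed.

Lemma mean_ext f g : f =1 g -> mean f = mean g.
Proof. by move/funext ->. Qed.

Lemma realcM (r x y : R) : r%:C * (x +i* y) = (r * x) +i* (r * y).
Proof. by apply/eqP; rewrite eq_complex /= !mul0r subr0 addr0 !eqxx. Qed.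

Lemma mean_cst c : mean (fun=> c) = c.
Proof.
have mu2pi : fine (mu I2pi) = 2 * pi.
  by rewrite lebesgue_measure_itv /= lte_fin twopi_gt0 /= oppr0 addr0.
have int_cst (r : R) : \int[mu]_(t in I2pi) r = r * (2 * pi).
  by rewrite Rintegral_cst //; congr (_ * _).
have h := lt0r_neq0 twopi_gt0; case: c => a b.
by rewrite /mean !int_cst realcM; congr (_ +i* _); rewrite mulrCA mulVf ?mulr1.
Qed.

Lemma mean_sum (I : eqType) (r : seq I) (F : I -> circle R -> R[i]) :
  (forall i, ccontinuous (F i)) ->
  mean (fun z => \sum_(i <- r) F i z) = \sum_(i <- r) mean (F i).
Proof.
move=> cF; elim: r => [|a r IH].
  by rewrite big_nil -[RHS](mean_cst 0); apply: mean_ext => z; rewrite big_nil.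
rewrite big_cons -IH -meanD //; last exact: ccontinuous_sum.
by apply: mean_ext => z; rewrite big_cons.
Qed.

(** The constant 2 comes from estimating the real and the imaginary part
    separately; its value is immaterial below. *)
Lemma normc_mean_le f g : ccontinuous f -> ccontinuous g ->
  (forall z, nc (f z) <= complex.Re (g z)) -> nc (mean f) <= 2 * complex.Re (mean g).
Proof.
move=> cf cg fg.
have cRf := continuous_Re_expi cf; have cIf := continuous_Im_expi cf.
have cRg := continuous_Re_expi cg.
have p0 : 0 <= (2 * pi)^-1 :> R by rewrite invr_ge0 ltW // twopi_gt0.
have key (h : R -> R) : continuous h -> (forall t, `|h t| <= complex.Re (g (expi t))) ->
    `|\int[mu]_(t in I2pi) h t| <= \int[mu]_(t in I2pi) complex.Re (g (expi t)).
  move=> ch hg; apply: le_trans (le_normr_Rintegral _ _) _; first exact: measurable_itv.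
    exact: continuous_integrable.
  apply: le_Rintegral => //; last exact: continuous_integrable.
  apply: continuous_integrable => t; apply: continuous_comp; first exact: ch.
  exact: norm_continuous.
rewrite /mean Normc.normcM normc_real ger0_norm // realcM [complex.Re _]/=.
rewrite mulrCA ler_wpM2l //.
apply: le_trans (normc_le_ReIm _) _; rewrite [leRHS]mulr_natl [leRHS]mulr2n /=.
by apply: lerD; apply: key => // t; [apply: le_trans (Re_le_normc _) _ | apply: le_trans
  (Im_le_normc _) _].
Qed.

Lemma expi_exprz (t : R) (n : int) : \val (expi t) ^ n = cos (n%:~R * t) +i* sin (n%:~R *
  t).
Proof.
have nat_case (k : nat) : \val (expi t) ^+ k = cos (k%:R * t) +i* sin (k%:R * t).
  elim: k => [|k IH]; first by rewrite expr0 mul0r cos0 sin0.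
  rewrite exprS IH val_expi [LHS]/GRing.mul /= -natr1 mulrDl mul1r cosD sinD.
  by congr (_ +i* _); ring.
case: n => k; first exact: nat_case.
rewrite NegzE.
have -> : \val (expi t) ^ (- k.+1%:Z) = (\val (expi t) ^+ k.+1)^-1 by [].
rewrite nat_case mulrNz mulNr cosN sinN /GRing.inv /=.
by rewrite cos2Dsin2 !divr1.
Qed.

(** Orthogonality of the characters of the circle: cos (c t) and sin (c t) have
    2pi-periodic primitives when c is a nonzero integer. *)
Lemma mean_exprz (n : int) : n != 0 -> mean (fun z => \val z ^ n) = 0.
Proof.
move=> n0; have c0 : n%:~R != 0 :> R by rewrite intr_eq0.
set c : R := n%:~R in c0.
have cont_lin (h : R -> R) : continuous h -> continuous (fun t : R => h (c * t)).
  move=> ch t; apply: continuous_comp; last exact: ch.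
  by apply: cvgM; [exact: cvg_cst | exact: cvg_id].
have dlin (s s' : R -> R) t : is_derive (c * t) 1 s (s' (c * t)) ->
    is_derive t 1 (fun t => c^-1 * s (c * t)) (s' (c * t)).
  move=> ds; have dc : is_derive t 1 ( *%R c : R -> R) c.
    by apply: is_derive_eq; exact: mulr1.
  have d1 := is_derive1_comp ds dc.
  have := is_deriveZ (c^-1) d1.
  by move/is_derive_eq; apply; rewrite [LHS]mulrC mulfK.
have int0 (h F : R -> R) : continuous h -> (forall t : R, is_derive t 1 F (h t)) ->
    F (2 * pi) = F 0 -> \int[mu]_(t in I2pi) h t = 0.
  move=> ch dF F0.
  have cF : continuous F.
    by move=> t; apply/differentiable_continuous/derivable1_diffP; case: (dF t).
  rewrite /Rintegral (@continuous_FTC2 _ _ F) ?twopi_gt0 //.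
  - by rewrite F0 subee.
  - exact: continuous_subspaceT.
  - split; first by move=> t _; case: (dF t).
      by apply: cvg_at_right_filter; exact: cF.
    by apply: cvg_at_left_filter; exact: cF.
  - by move=> t _; rewrite derive1E derive_val.
have e2pi : cos (c * (2 * pi)) +i* sin (c * (2 * pi)) = 1 :> R[i].
  rewrite -expi_exprz.
  have -> : \val (expi (2 * pi)) = 1 :> R[i].
    by rewrite val_expi mulr_natl cos2pi sin2pi.
  by rewrite exp1rz.
have ec : cos (c * (2 * pi)) = 1 := congr1 (@complex.Re R) e2pi.
have es : sin (c * (2 * pi)) = 0 := congr1 (@complex.Im R) e2pi.
rewrite /mean (_ : _ +i* _ = 0) ?mulr0 //.
congr (_ +i* _).
  transitivity (\int[mu]_(t in I2pi) cos (c * t)).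
    by apply: eq_Rintegral => t _; rewrite expi_exprz.
  apply: (int0 _ _ (cont_lin _ (@continuous_cos R)) (fun t => dlin sin cos t
    (is_derive_sin _))).
  by rewrite mulr0 sin0; congr (_ * _).
transitivity (\int[mu]_(t in I2pi) sin (c * t)).
  by apply: eq_Rintegral => t _; rewrite expi_exprz.
have dNcos (t : R) : is_derive (c * t) 1 (fun t => - cos t) (sin (c * t)).
  by apply: is_derive_eq; rewrite opprK.
apply: (int0 _ _ (cont_lin _ (@continuous_sin R)) (fun t => dlin (fun t => - cos t) sin t
  (dNcos t))).
by rewrite mulr0 cos0; congr (_ * - _).
Qed.

End Mean.

(** * Fourier coefficients and Fejer means *)

Section Fejer.
Variable R : realType.
Local Notation nc := (@Normc.normc R).
Implicit Types (phi psi : circle R -> R[i]) (q : circle R).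

Lemma ccontinuous_fourier phi (n : int) : ccontinuous phi ->
  ccontinuous (fun z => phi z * \val z ^ n).
Proof. by move=> c; exact: (ccontinuousM c (ccontinuous_exprz n)). Qed.

Lemma fourier_ext phi psi n : phi =1 psi -> fourier phi n = fourier psi n.
Proof. by move/funext ->. Qed.

Lemma fourierD phi psi n : ccontinuous phi -> ccontinuous psi ->
  fourier (fun z => phi z + psi z) n = fourier phi n + fourier psi n.
Proof.
move=> c1 c2; rewrite !fourier_mean -meanD; try exact: ccontinuous_fourier.
by apply: mean_ext => z; rewrite mulrDl.
Qed.

Lemma fourierZ (c : R[i]) phi n : ccontinuous phi ->
  fourier (fun z => c * phi z) n = c * fourier phi n.
Proof.
move=> c1; rewrite !fourier_mean -meanZ; last exact: ccontinuous_fourier.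
by apply: mean_ext => z; rewrite mulrA.
Qed.

Lemma fourierB phi psi n : ccontinuous phi -> ccontinuous psi ->
  fourier (fun z => phi z - psi z) n = fourier phi n - fourier psi n.
Proof.
move=> c1 c2; rewrite -mulN1r -fourierZ // -fourierD //; last exact: ccontinuousZ.
by apply: fourier_ext => z; rewrite mulN1r.
Qed.

Lemma fourier_sum (I : eqType) (r : seq I) (F : I -> circle R -> R[i]) n :
  (forall i, ccontinuous (F i)) ->
  fourier (fun z => \sum_(i <- r) F i z) n = \sum_(i <- r) fourier (F i) n.
Proof.
move=> cF; transitivity (mean (fun z => \sum_(i <- r) F i z * \val z ^ (- n))).
  by rewrite fourier_mean; apply: mean_ext => z; rewrite mulr_suml.
by rewrite mean_sum // => i; exact: ccontinuous_fourier.
Qed.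

Lemma fourier_shift (m : int) phi n :
  fourier (fun z => \val z ^ m * phi z) n = fourier phi (n - m).
Proof.
rewrite !fourier_mean; apply: mean_ext => z.
by rewrite opprB expfzDr ?val_circle_neq0 // mulrCA mulrA.
Qed.

Lemma fourier_exprz (m n : int) : fourier (fun z : circle R => \val z ^ m) n = (n == m)%:R.
Proof.
rewrite fourier_mean (@mean_ext _ _ (fun z => \val z ^ (m - n))); last first.
  by move=> z; rewrite expfzDr // val_circle_neq0.
have [->|nm] := eqVneq n m; last by rewrite mean_exprz // subr_eq0 eq_sym.
by rewrite subrr (@mean_ext _ _ (fun=> 1)) ?mean_cst // => z; rewrite expr0z.
Qed.

Lemma normc_fourier_le phi n (r : R) : ccontinuous phi ->
  (forall z, nc (phi z) <= r) -> nc (fourier phi n) <= 2 * r.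
Proof.
move=> cp pr; rewrite fourier_mean.
have := @normc_mean_le _ _ _ (ccontinuous_fourier (- n) cp) (ccontinuous_cst r%:C).
rewrite mean_cst /=; apply => z.
by rewrite Normc.normcM normc_circle_exprz mulr1 pr.
Qed.

(** The value at q of the N-th Fejer mean of phi, written as a double sum: the
    coefficient of index d occurs once for each of the pairs j, l with l - j = d. *)
Definition fejer phi (N : nat) q : R[i] :=
  N%:R^-1 * \sum_(j < N) \sum_(l < N)
    \val q ^ (l%:Z - j%:Z) * fourier phi (l%:Z - j%:Z).

(** The Fejer kernel centred at q, in the form that makes its nonnegativity
    visible. *)
Definition fejer_kernel (N : nat) q (z : circle R) : R :=
  N%:R^-1 * nc (\sum_(j < N) (\val z / \val q) ^+ j) ^+ 2.

Lemma fejer_kernelE N q z : (fejer_kernel N q z)%:C =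
  N%:R^-1 * \sum_(j < N) \sum_(l < N) \val q ^ (l%:Z - j%:Z) * \val z ^ (j%:Z - l%:Z).
Proof.
rewrite rmorphM /= fmorphV /= rmorph_nat -mulc_conj; congr (_ * _).
rewrite rmorph_sum /= mulr_suml; apply: eq_bigr => j _.
rewrite mulr_sumr; apply: eq_bigr => l _.
rewrite rmorphXn /=; set w := \val z / \val q.
have w0 : w != 0 by rewrite mulf_neq0 ?invr_eq0 ?val_circle_neq0.
have -> : conjc w = w^-1.
  apply: (mulfI w0); rewrite divff // mulc_conj Normc.normcM Normc.normcV.
  by rewrite !normc_circle divr1 expr1n.
have -> : w ^+ j * w^-1 ^+ l = w ^ (j%:Z - l%:Z).
  by rewrite expfzDr // exprVn exprnN.
by rewrite /w expfzMl exprz_inv opprB mulrC.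
Qed.

Lemma mean_fejer phi N q : ccontinuous phi ->
  mean (fun z => (fejer_kernel N q z)%:C * phi z) = fejer phi N q.
Proof.
move=> cp; have cF (j l : nat) : ccontinuous (fun z => \val q ^ (l%:Z - j%:Z) *
    (phi z * \val z ^ (- (l%:Z - j%:Z)))).
  by apply: ccontinuousZ; exact: ccontinuous_fourier.
rewrite (@mean_ext _ _ (fun z => N%:R^-1 * \sum_(j < N) \sum_(l < N)
    \val q ^ (l%:Z - j%:Z) * (phi z * \val z ^ (- (l%:Z - j%:Z))))).
  rewrite meanZ; last by apply: ccontinuous_sum => j _; apply: ccontinuous_sum.
  rewrite /fejer; congr (_ * _); rewrite mean_sum; last first.
    by move=> j; apply: ccontinuous_sum.
  apply: eq_bigr => j _; rewrite mean_sum //; apply: eq_bigr => l _.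
  by rewrite meanZ //; exact: ccontinuous_fourier.
move=> z; rewrite fejer_kernelE -mulrA mulr_suml; congr (_ * _).
apply: eq_bigr => j _; rewrite mulr_suml; apply: eq_bigr => l _.
by rewrite opprB -mulrA [_ * phi z]mulrC.
Qed.

Lemma fejer_cst N q (c : R[i]) : (0 < N)%N -> fejer (fun=> c) N q = c.
Proof.
move=> N0; rewrite /fejer.
have F n : fourier (fun=> c : R[i]) n = c * (n == 0)%:R.
  rewrite -(fourier_exprz 0 n) -fourierZ; last exact: ccontinuous_exprz.
  by apply: fourier_ext => z; rewrite expr0z mulr1.
rewrite (eq_bigr (fun=> c)) => [|j _].
  by rewrite sumr_const card_ord -[c *+ N]mulr_natl mulKf // pnatr_eq0 -lt0n.
rewrite (bigD1 j) //= subrr expr0z F eqxx mul1r mulr1 big1 ?addr0 // => l lj.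
have lj' : (l == j :> nat) = false by apply/negbTE.
by rewrite F subr_eq0 eqz_nat lj' !mulr0.
Qed.

Lemma fejer_kernel_ge0 N q z : 0 <= fejer_kernel N q z.
Proof. by rewrite mulr_ge0 ?invr_ge0 ?ler0n // sqr_ge0. Qed.

(** Away from q the kernel is small because (w - 1) * \sum_(j < N) w ^+ j is
    w ^+ N - 1, whose modulus is at most 2. *)
Lemma fejer_kernel_le N q z (d : R) : 0 < d -> d <= nc (\val z - \val q) ->
  fejer_kernel N q z <= 4 / d ^+ 2 * N%:R^-1.
Proof.
move=> d0 dz; rewrite /fejer_kernel mulrC ler_wpM2r ?invr_ge0 ?ler0n //.
set w := \val z / \val q; set D := \sum_(j < N) _.
have ncw : nc w = 1 by rewrite Normc.normcM Normc.normcV !normc_circle divr1.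
have wd : d <= nc (w - 1).
  apply: le_trans dz _; rewrite -[leLHS]mulr1 -{1}(invr1 R) -(normc_circle q).
  by rewrite -Normc.normcV -Normc.normcM mulrBl divff ?val_circle_neq0.
have wD : nc (w - 1) * nc D <= 2.
  rewrite -Normc.normcM -subrX1; apply: le_trans (normcD _ _) _.
  by rewrite normcNE normcX ncw expr1n Normc.normc1.
rewrite ler_pdivlMr ?exprn_gt0 // -exprMn (_ : 4 = 2 ^+ 2); last by ring.
rewrite ler_sqr ?nnegrE ?mulr_ge0 ?normc_ge0 //; last exact: ltW.
by apply: le_trans wD; rewrite mulrC ler_wpM2r ?normc_ge0.
Qed.

(** Pointwise Fejer theorem: near q the modulus of phi - phi q is at most e / 4, and
    elsewhere the kernel is bounded by fejer_kernel_le. *)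
Lemma fejer_cvg phi q (e : R) : ccontinuous phi -> 0 < e ->
  exists2 N, (0 < N)%N & nc (fejer phi N q - phi q) < e.
Proof.
move=> cp e0; have e4 : 0 < e / 4 by rewrite divr_gt0.
have [d d0 dP] := cp q _ e4.
(* m is the mean of |phi - phi q|, which weights the bound of the kernel away
   from q *)
pose h z : R[i] := (nc (phi z - phi q))%:C.
have ch : ccontinuous h.
  move=> z r r0; have [d' d'0 h'] := cp z _ r0; exists d' => // w /h'.
  apply: le_lt_trans; rewrite /h -rmorphB normc_real.
  apply: le_trans (normc_dist _ _) _.
  by rewrite opprB addrA subrK.
pose m := complex.Re (mean h).
have m0 : 0 <= m.
  have := @normc_mean_le _ _ _ ch ch; rewrite -/m => H.
  have : nc (mean h) <= 2 * m by apply: H => z; rewrite /h normc_real ger0_norm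
    ?normc_ge0 //; exact: lexx.
  by move=> /(le_trans (normc_ge0 _)); rewrite pmulr_rge0.
pose C := 4 / d ^+ 2 * m.
have C0 : 0 <= C by rewrite mulr_ge0 ?divr_ge0 ?sqr_ge0.
have Ce : 0 <= 4 * C / e by apply: divr_ge0 (ltW e0); apply: mulr_ge0.
have [N NP] : exists N : nat, 4 * C / e < N%:R.
  by exists (Num.bound (4 * C / e)); exact: archi_boundP.
have N0 : (0 < N)%N.
  by rewrite -(ltr_nat R); apply: le_lt_trans NP.
exists N => //.
have cK : ccontinuous (fun z => (fejer_kernel N q z)%:C).
  apply: (@ccontinuous_ext _ (fun z => N%:R^-1 * \sum_(j < N) \sum_(l < N)
      \val q ^ (l%:Z - j%:Z) * \val z ^ (j%:Z - l%:Z))).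
    by move=> z; rewrite fejer_kernelE.
  apply: ccontinuousZ; apply: ccontinuous_sum => j _; apply: ccontinuous_sum => l _.
  by apply: ccontinuousZ; exact: ccontinuous_exprz.
have cB : ccontinuous (fun z => phi z - phi q).
  by apply: (ccontinuousD cp); exact: ccontinuous_cst.
have -> : fejer phi N q - phi q = mean (fun z => (fejer_kernel N q z)%:C * (phi z - phi q)).
  have c1 := ccontinuousM cK cp; have c2 := ccontinuousM cK (ccontinuous_cst (phi q)).
  have c3 := ccontinuousZ (-1) c2.
  rewrite -{1}(fejer_cst q (phi q) N0) -(mean_fejer N q cp).
  rewrite -(mean_fejer N q (ccontinuous_cst (phi q))) -mulN1r -(meanZ (-1) c2).
  by rewrite -(meanD c1 c3); apply: mean_ext => z; ring.
pose g z : R[i] := (e / 4)%:C * (fejer_kernel N q z)%:C + (4 / d ^+ 2 * N%:R^-1)%:C * h z.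
have cg : ccontinuous g by apply: ccontinuousD; apply: ccontinuousZ.
apply: le_lt_trans (normc_mean_le _ cg _) _.
- exact: ccontinuousM.
- move=> z; rewrite Normc.normcM normc_real ger0_norm ?fejer_kernel_ge0 //.
  rewrite /g /h -!rmorphM -rmorphD /=.
  have K0 := fejer_kernel_ge0 N q z; have n0 := normc_ge0 (phi z - phi q).
  have c0 : 0 <= 4 / d ^+ 2 * N%:R^-1.
    by apply: mulr_ge0; [apply: divr_ge0 => //; exact: sqr_ge0 | rewrite invr_ge0 ler0n].
  have [zq|zq] := ltP (nc (\val z - \val q)) d.
    apply: ler_wpDr; first exact: (mulr_ge0 c0 n0).
    by rewrite mulrC; apply: ler_wpM2r => //; apply/ltW/dP.
  apply: ler_wpDl; first exact: (mulr_ge0 (ltW e4) K0).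
  by apply: ler_wpM2r => //; exact: fejer_kernel_le.
rewrite /g meanD; try exact: ccontinuousZ.
rewrite !meanZ //.
have ReD (x y : R[i]) : complex.Re (x + y) = complex.Re x + complex.Re y by rewrite raddfD.
have ReM (r : R) (x : R[i]) : complex.Re (r%:C * x) = r * complex.Re x.
  by case: x => a b; rewrite realcM.
rewrite ReD (ReM (e / 4)) (ReM (4 / d ^+ 2 * N%:R^-1)) -/m.
have -> : mean (fun z => (fejer_kernel N q z)%:C) = 1.
  rewrite -(fejer_cst q 1 N0) -mean_fejer; last exact: ccontinuous_cst.
  by apply: mean_ext => z; rewrite mulr1.
rewrite mulr1.
have CN : 4 / d ^+ 2 * N%:R^-1 * m < e / 4.
  rewrite mulrAC -/C ltr_pdivrMr ?ltr0n //.
  have {}NP : 4 * C < N%:R * e by rewrite -ltr_pdivrMr.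
  by lra.
by move: CN; set y := _ * m; lra.
Qed.

End Fejer.

(** * Coefficient algebras and their characters; the supremum norm *)

Section CoefficientNorms.
Variable R : realType.
Local Notation nc := (@Normc.normc R).
Local Notation cfun := (circle R -> R[i]).
Implicit Types (phi psi : cfun) (q z : circle R) (c d : R).

(** The Banach algebra of coefficients of the series, presented by the relation
    nb phi c, which says that phi belongs to the algebra and has norm at most c.
    The last field expresses completeness, in terms of absolutely convergent
    series; membership of all z ^ n with norm 1 makes z invertible. *)
Record coef_norm (nb : cfun -> R -> Prop) : Prop := CoefNorm {
  nb_ccont : forall phi c, nb phi c -> ccontinuous phi;
  nb_ev : forall phi c, nb phi c -> forall z, nc (phi z) <= c;
  nb_le : forall phi c d, nb phi c -> c <= d -> nb phi d;
  nbD : forall phi psi c d, nb phi c -> nb psi d -> nb (fun z => phi z + psi z) (c + d);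
  nbZ : forall (k : R[i]) phi c, nb phi c -> nb (fun z => k * phi z) (nc k * c);
  nbM : forall phi psi c d, nb phi c -> nb psi d -> nb (fun z => phi z * psi z) (c * d);
  nb_cpow : forall phi c n, nb phi c -> nb (fun z => phi (cpow z n)) c;
  nb_exprz : forall n : int, nb (fun z => \val z ^ n) 1;
  nb_sums : forall (phi_ : nat -> cfun) (c_ : nat -> R) Phi M,
    (forall k, nb (phi_ k) (c_ k)) -> (forall N, \sum_(k < N) c_ k <= M) ->
    (forall z, sums (phi_ ^~ z) (Phi z)) -> nb Phi M }.

(** A character of the coefficient algebra, bounded by the norm, whose value on
    the identity function is the point q of the circle. *)
Record bounded_char (nb : cfun -> R -> Prop) (lam : cfun -> R[i]) q : Prop :=
  BoundedChar {
  charD : forall phi psi c d, nb phi c -> nb psi d ->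
    lam (fun z => phi z + psi z) = lam phi + lam psi;
  charZ : forall (k : R[i]) phi c, nb phi c -> lam (fun z => k * phi z) = k * lam phi;
  charM : forall phi psi c d, nb phi c -> nb psi d ->
    lam (fun z => phi z * psi z) = lam phi * lam psi;
  char1 : lam (fun=> 1) = 1;
  char_le : forall phi c, nb phi c -> nc (lam phi) <= c;
  char_val : lam (fun z => \val z) = \val q }.

Lemma sums_uniform (phi_ : nat -> cfun) (c_ : nat -> R) Phi M :
  (forall k z, nc (phi_ k z) <= c_ k) -> (forall N, \sum_(k < N) c_ k <= M) ->
  (forall z, sums (phi_ ^~ z) (Phi z)) ->
  forall e, 0 < e -> exists K, forall z, nc (Phi z - \sum_(k < K) phi_ k z) <= e.
Proof.
move=> pc cM sP e e0.
have c0 k : 0 <= c_ k by apply: le_trans (pc k (expi 0)); exact: normc_ge0.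
have [K KP] := bounded_tail c0 cM e0; exists K => z.
apply: (@sums_normc_le _ (fun k => phi_ (K + k)%N z)); last exact: (sums_shift _ (sP z)).
move=> N.
apply: le_trans (ltW (KP N)); apply: ler_sum => k _; exact: pc.
Qed.

Lemma ccontinuous_sums (phi_ : nat -> cfun) (c_ : nat -> R) Phi M :
  (forall k, ccontinuous (phi_ k)) ->
  (forall k z, nc (phi_ k z) <= c_ k) -> (forall N, \sum_(k < N) c_ k <= M) ->
  (forall z, sums (phi_ ^~ z) (Phi z)) -> ccontinuous Phi.
Proof.
move=> cp pc cM sP q e e0; have e4 : 0 < e / 4 by rewrite divr_gt0.
have [K KP] := sums_uniform pc cM sP e4.
have cS : ccontinuous (fun z => \sum_(k < K) phi_ k z).
  by apply: ccontinuous_sum => k _; exact: cp.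
have [d d0 dP] := cS q _ e4; exists d => // z /dP zq.
set S := fun z => \sum_(k < K) phi_ k z in zq KP.
have -> : Phi z - Phi q = (Phi z - S z) + ((S z - S q) - (Phi q - S q)) by ring.
apply: le_lt_trans (normcD _ _) _.
apply: le_lt_trans (lerD (KP z) (normcD _ _)) _; rewrite normcNE.
apply: le_lt_trans (lerD (lexx _) (lerD (ltW zq) (KP q))) _.
by lra.
Qed.

(** The algebra of all continuous functions with the supremum norm. *)
Definition sup_bound phi c : Prop := ccontinuous phi /\ forall z, nc (phi z) <= c.

Lemma sup_bound_coef_norm : coef_norm sup_bound.
Proof.
split.
- by move=> phi c [].
- by move=> phi c [].
- by move=> phi c d [cp pc] cd; split=> // z; apply: le_trans cd.
- move=> phi psi c d [cp pc] [cq qd]; split=> [|z]; first exact: ccontinuousD.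
  by apply: le_trans (normcD _ _) _; exact: lerD.
- move=> k phi c [cp pc]; split=> [|z]; first exact: ccontinuousZ.
  by rewrite Normc.normcM ler_wpM2l ?normc_ge0.
- move=> phi psi c d [cp pc] [cq qd]; split=> [|z]; first exact: ccontinuousM.
  by rewrite Normc.normcM ler_pM ?normc_ge0.
- by move=> phi c n [cp pc]; split=> [|z //]; exact: ccontinuous_cpow.
- move=> n; split=> [|z]; first exact: ccontinuous_exprz.
  by rewrite normc_circle_exprz.
- move=> phi_ c_ Phi M h cM sP.
  have cp k := (h k).1; have pc k := (h k).2.
  split=> [|z]; first exact: (ccontinuous_sums cp pc cM sP).
  apply: (sums_normc_le _ (sP z)) => N.
  by apply: le_trans (cM N); apply: ler_sum => k _; exact: pc.
Qed.

Section Generic.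
Variables (nb : cfun -> R -> Prop) (nbP : coef_norm nb).

Lemma nb_ext phi psi c : phi =1 psi -> nb phi c -> nb psi c.
Proof. by move/funext ->. Qed.

Lemma nb1 : nb (fun=> 1) 1.
Proof. by apply: nb_ext (nb_exprz nbP 0) => z; rewrite expr0z. Qed.

Lemma nb_cst k : nb (fun=> k) (nc k).
Proof.
by have := nbZ nbP k nb1; rewrite !mulr1.
Qed.

Lemma nb0 : nb (fun=> 0) 0.
Proof. by have := nb_cst 0; rewrite Normc.normc0. Qed.

Lemma nb_val : nb (fun z => \val z) 1.
Proof. by apply: nb_ext (nb_exprz nbP 1) => z; rewrite expr1z. Qed.

Lemma nbB phi psi c d : nb phi c -> nb psi d -> nb (fun z => phi z - psi z) (c + d).
Proof.
move=> np nq; have := nbD nbP np (nbZ nbP (-1) nq).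
rewrite normcNE Normc.normc1 mul1r; apply: nb_ext => z; by rewrite mulN1r.
Qed.

Lemma nb_ge0 phi c : nb phi c -> 0 <= c.
Proof. by move=> np; apply: le_trans (nb_ev nbP np (expi 0)); exact: normc_ge0. Qed.

Lemma nb_sum (I : Type) (r : seq I) (P : pred I) (F : I -> cfun) (c_ : I -> R) :
  (forall i, P i -> nb (F i) (c_ i)) ->
  nb (fun z => \sum_(i <- r | P i) F i z) (\sum_(i <- r | P i) c_ i).
Proof.
move=> h; elim: r => [|a r IH].
  by rewrite big_nil; apply: nb_ext nb0 => z; rewrite big_nil.
rewrite big_cons; case: ifPn => Pa; last first.
  by apply: nb_ext IH => z; rewrite big_cons (negbTE Pa).
by apply: nb_ext (nbD nbP (h _ Pa) IH) => z; rewrite big_cons Pa.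
Qed.

Lemma nb_exp phi c n : nb phi c -> nb (fun z => phi z ^+ n) (c ^+ n).
Proof.
move=> np; elim: n => [|n IH].
  by rewrite expr0; apply: nb_ext nb1 => z; rewrite expr0.
by rewrite exprS; apply: nb_ext (nbM nbP np IH) => z; rewrite exprS.
Qed.

Section Char.
Variables (lam : cfun -> R[i]) (q : circle R) (lamP : bounded_char nb lam q).

Lemma char_cst k : lam (fun=> k) = k.
Proof.
transitivity (lam (fun=> k * 1)); first by rewrite mulr1.
by rewrite (charZ lamP k nb1) (char1 lamP) mulr1.
Qed.

Lemma charB phi psi c d : nb phi c -> nb psi d ->
  lam (fun z => phi z - psi z) = lam phi - lam psi.
Proof.
move=> np nq; rewrite -mulN1r -(charZ lamP (-1) nq).
rewrite -(charD lamP np (nbZ nbP _ nq)); congr lam.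
by apply/funext => z; rewrite mulN1r.
Qed.

Lemma char_exp phi c n : nb phi c -> lam (fun z => phi z ^+ n) = lam phi ^+ n.
Proof.
move=> np; elim: n => [|n IH].
  rewrite expr0 -(char1 lamP); congr lam; exact/funext.
rewrite exprS -IH -(charM lamP np (nb_exp n np)); congr lam.
by apply/funext => z; rewrite exprS.
Qed.

Lemma char_exprz (m : int) : lam (fun z => \val z ^ m) = \val q ^ m.
Proof.
have pos (n : nat) : lam (fun z => \val z ^ (n : int)) = \val q ^ (n : int).
  by have := char_exp n nb_val; rewrite (char_val lamP).
case: m => n; first exact: pos.
have := charM lamP (nb_exprz nbP n.+1) (nb_exprz nbP (Negz n)).
rewrite pos (_ : (fun _ => _) = fun=> 1); last first.
  apply/funext => z; rewrite NegzE -expfzDr ?val_circle_neq0 // subrr.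
  by rewrite expr0z.
rewrite (char1 lamP) => /esym h.
have q0 : \val q ^ (n.+1 : int) != 0 by rewrite expfz_neq0 // val_circle_neq0.
apply: (mulfI q0); rewrite h NegzE -expfzDr ?val_circle_neq0 // subrr.
by rewrite expr0z.
Qed.

Lemma char_sum (I : Type) (r : seq I) (F : I -> cfun) (c_ : I -> R) :
  (forall i, nb (F i) (c_ i)) ->
  lam (fun z => \sum_(i <- r) F i z) = \sum_(i <- r) lam (F i).
Proof.
move=> h; elim: r => [|a r IH].
  rewrite big_nil -[RHS](char_cst 0); congr lam.
  by apply/funext => z; rewrite big_nil.
rewrite big_cons -IH -(charD lamP (h a) (nb_sum r (fun i _ => h i))); congr lam.
by apply/funext => z; rewrite big_cons.
Qed.

End Char.
End Generic.

(** The trigonometric polynomial |1 + z / q|^2 / 4, with values in [0, 1], which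
    takes the value 1 at q only. *)
Definition peak q z : R := nc (1 + \val z / \val q) ^+ 2 / 4.

Lemma conjc_unit (w : R[i]) : nc w = 1 -> conjc w = w^-1.
Proof.
move=> w1; have w0 : w != 0 by apply/eqP => w0; move: w1; rewrite w0 Normc.normc0 =>
  /esym/eqP; rewrite oner_eq0.
by apply: (mulfI w0); rewrite divff // mulc_conj w1 expr1n.
Qed.

Lemma peakE q z : (peak q z)%:C =
  4^-1 * (2 + (\val q)^-1 * \val z ^ (1 : int) + \val q * \val z ^ (-1 : int)).
Proof.
have zq : nc (\val z / \val q) = 1 by rewrite Normc.normcM Normc.normcV !normc_circle divr1.
have E : (nc (1 + \val z / \val q) ^+ 2)%:C =
    (1 + \val z / \val q) * (1 + (\val z / \val q)^-1).
  rewrite -mulc_conj -(conjc_unit zq); congr (_ * _).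
  by case: (_ / _) => a b; apply/eqP; rewrite eq_complex /= !add0r !eqxx.
rewrite /peak rmorphM /= E fmorphV /= rmorph_nat expr1z exprN1.
by field; rewrite !val_circle_neq0.
Qed.

(** Parallelogram identity: |1 + w|^2 + |1 - w|^2 = 4 on the circle. *)
Lemma peak_le q z d : 0 < d -> d <= nc (\val z - \val q) -> peak q z <= 1 - d ^+ 2 / 4.
Proof.
move=> d0 dz.
set w := \val z / \val q.
have w1 : nc w = 1 by rewrite Normc.normcM Normc.normcV !normc_circle divr1.
have dw : d <= nc (1 - w).
  apply: le_trans dz _; rewrite -[leLHS]mulr1 -{1}(invr1 R) -(normc_circle q).
  rewrite -Normc.normcV -Normc.normcM mulrBl divff ?val_circle_neq0 // normc_distC.
  exact: lexx.
have par : nc (1 + w) ^+ 2 + nc (1 - w) ^+ 2 = 4.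
  have E : nc w ^+ 2 = 1 by rewrite w1 expr1n.
  move: E; case: (w) => a b; rewrite /= !sqr_sqrtr ?addr_ge0 ?sqr_ge0 //.
  by move=> E; rewrite add0r sub0r sqrrN; lra.
have dd : d ^+ 2 <= nc (1 - w) ^+ 2.
  by rewrite ler_sqr ?nnegrE ?normc_ge0 // ltW.
rewrite /peak -/w; lra.
Qed.

Lemma peak_ge0 q z : 0 <= peak q z.
Proof. by rewrite divr_ge0 ?sqr_ge0. Qed.

Lemma peak_le1 q z : peak q z <= 1.
Proof.
rewrite /peak ler_pdivrMr // mul1r (_ : 4 = 2 ^+ 2); last by ring.
rewrite ler_sqr ?nnegrE ?normc_ge0 //; apply: le_trans (normcD _ _) _.
by rewrite Normc.normcM Normc.normcV Normc.normc1 !normc_circle divr1.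
Qed.

(** Bounded characters of C(T) are evaluations.  If psi vanishes at q, then multiplying
    it by high powers of the peak function at q does not change lam psi, but makes
    its norm arbitrarily small. *)
Lemma sup_bound_char lam q phi c :
  bounded_char sup_bound lam q -> sup_bound phi c -> lam phi = phi q.
Proof.
move=> lamP; have nbP := sup_bound_coef_norm.
have nbpeak : sup_bound (fun z => (peak q z)%:C) 1.
  split=> [|z]; last by rewrite normc_real ger0_norm ?peak_ge0 ?peak_le1.
  apply: ccontinuous_ext (fun z => esym (peakE q z)) _.
  apply: ccontinuousZ; apply: ccontinuousD.
    by apply: (ccontinuousD (ccontinuous_cst _)); apply: ccontinuousZ; exact:
      ccontinuous_exprz.
  by apply: ccontinuousZ; exact: ccontinuous_exprz.
have lampeak : lam (fun z => (peak q z)%:C) = 1.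
  rewrite (funext (peakE q)).
  have n1 := nbZ nbP (\val q)^-1 (nb_exprz nbP 1).
  have n2 := nbZ nbP (\val q) (nb_exprz nbP (-1)).
  have n0 := nb_cst nbP 2; have n01 := nbD nbP n0 n1.
  rewrite (charZ lamP _ (nbD nbP n01 n2)) (charD lamP n01 n2) (charD lamP n0 n1).
  rewrite (char_cst nbP lamP) (charZ lamP _ (nb_exprz nbP 1)).
  rewrite (charZ lamP _ (nb_exprz nbP (-1))) !(char_exprz nbP lamP).
  by rewrite -peakE /peak divff ?val_circle_neq0 //= !addr0 expr0n addr0 sqr_sqrtr
    ?sqr_ge0 //; congr (_%:C); field.
(* d is capped at 1 to make the ratio r nonnegative *)
have vanish psi b : sup_bound psi b -> psi q = 0 -> lam psi = 0.
  move=> [cp pb] pq; apply: Normc.eq0_normc; apply/eqP; rewrite eq_le normc_ge0 andbT.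
  apply/ler_addgt0Pr => e e0; rewrite add0r.
  have [d0 d00 d0P] := cp q _ e0.
  pose d := Num.min d0 1.
  have dgt0 : 0 < d by rewrite lt_min d00 ltr01.
  have d1 : d <= 1 by rewrite ge_min lexx orbT.
  pose r := 1 - d ^+ 2 / 4.
  have d2 : d ^+ 2 <= 1 by rewrite expr_le1 // ltW.
  have d2' : 0 < d ^+ 2 by rewrite exprn_gt0.
  have r0 : 0 <= r by rewrite /r; lra.
  have r1 : r < 1 by rewrite /r; lra.
  have b0 : 0 <= b by apply: le_trans (pb q); exact: normc_ge0.
  have [n nP] : exists n, b * r ^+ n <= e.
    have := @cvg_geometric _ b r; rewrite ger0_norm // => /(_ r1) /cvgrPdist_le/(_ _
      e0)[n _ nP].
    exists n; have := nP n (leqnn n); rewrite /= sub0r normrN ger0_norm //.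
    by rewrite mulr_ge0 // exprn_ge0.
  have nbn := nb_exp nbP n nbpeak.
  have -> : lam psi = lam (fun z => psi z * (peak q z)%:C ^+ n).
    by rewrite (charM lamP (conj cp pb) nbn) (char_exp nbP lamP n nbpeak) lampeak expr1n
      mulr1.
  apply: (char_le lamP); split=> [|z]; first exact: (ccontinuousM cp nbn.1).
  rewrite Normc.normcM normcX normc_real ger0_norm ?peak_ge0 //.
  have pk0 := peak_ge0 q z.
  have [zq|zq] := ltP (nc (\val z - \val q)) d.
    rewrite -[e]mulr1; apply: ler_pM; rewrite ?normc_ge0 ?exprn_ge0 //.
      have := d0P z; rewrite pq subr0 => h; apply/ltW/h.
      by apply: lt_le_trans zq _; rewrite ge_min lexx.
    by rewrite exprn_ile1 // peak_le1.
  apply: le_trans nP; apply: ler_pM; rewrite ?normc_ge0 ?exprn_ge0 //.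
  by apply: lerXn2r; rewrite ?nnegrE //; exact: peak_le.
move=> np; have n0 := nb_cst nbP (phi q).
apply/eqP; rewrite -subr_eq0 -{1}(char_cst nbP lamP (phi q)); apply/eqP.
rewrite -(charB nbP lamP np n0).
by apply: (vanish _ _ (nbB nbP np n0)); rewrite subrr.
Qed.

End CoefficientNorms.

(** * The Wiener algebra *)

Section Wiener.
Variable R : realType.
Local Notation nc := (@Normc.normc R).
Local Notation cfun := (circle R -> R[i]).
Implicit Types (phi psi : cfun) (q z : circle R) (c d : R).

(** The Wiener algebra: phi is continuous and its Fourier coefficients have sum of
    moduli at most c.  The sum is tested on duplicate-free finite lists. *)
Definition wiener_bound phi c : Prop := ccontinuous phi /\
  forall s : seq int, uniq s -> \sum_(n <- s) nc (fourier phi n) <= c.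

Lemma wiener_bound_le phi c d : wiener_bound phi c -> c <= d -> wiener_bound phi d.
Proof. by move=> [cp pc] cd; split=> // s /pc; move/le_trans; apply. Qed.

Lemma wiener_bound_ge0 phi c : wiener_bound phi c -> 0 <= c.
Proof. by move=> [_ /(_ [::] isT)]; rewrite big_nil. Qed.

(** The Wiener norm dominates the values, because each Fejer mean of phi is
    dominated by it. *)
Lemma wiener_bound_ev phi c z : wiener_bound phi c -> nc (phi z) <= c.
Proof.
move=> [cp pc]; apply/ler_addgt0Pr => e e0.
have [N N0 NP] := fejer_cvg z cp e0.
rewrite -(subrK (fejer phi N z) (phi z)) addrC; apply: le_trans (normcD _ _) _.
rewrite normc_distC; apply: lerD (ltW NP).
rewrite /fejer Normc.normcM Normc.normcV -(rmorph_nat (real_complex R)) normc_real.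
rewrite normr_nat mulrC ler_pdivrMr ?ltr0n //.
apply: le_trans (normc_sum _ _ _) _.
apply: (@le_trans _ _ (\sum_(j < N) c)); last by rewrite sumr_const card_ord mulr_natr.
apply: ler_sum => j _; apply: le_trans (normc_sum _ _ _) _.
rewrite (eq_bigr (fun l : 'I_N => nc (fourier phi (l%:Z - j%:Z)))); last first.
  by move=> l _; rewrite Normc.normcM normc_circle_exprz mul1r.
have := pc [seq l%:Z - j%:Z | l <- iota 0 N].
rewrite big_map -[N in iota 0 N]subn0 -/(index_iota 0 N) big_mkord; apply.
rewrite map_inj_uniq ?iota_uniq // => a b /addIr; by case.
Qed.

Lemma wiener_boundZ (k : R[i]) phi c :
  wiener_bound phi c -> wiener_bound (fun z => k * phi z) (nc k * c).
Proof.
move=> [cp pc]; split=> [|s us]; first exact: ccontinuousZ.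
rewrite (eq_bigr (fun n => nc k * nc (fourier phi n))) => [|n _].
  by rewrite -mulr_sumr ler_wpM2l ?normc_ge0 // pc.
by rewrite fourierZ // Normc.normcM.
Qed.

Lemma wiener_boundD phi psi c d : wiener_bound phi c -> wiener_bound psi d ->
  wiener_bound (fun z => phi z + psi z) (c + d).
Proof.
move=> [cp pc] [cq qd]; split=> [|s us]; first exact: ccontinuousD.
apply: le_trans (lerD (pc s us) (qd s us)); rewrite -big_split.
by apply: ler_sum => n _; rewrite fourierD //; exact: normcD.
Qed.

Lemma wiener_bound_shift (m : int) phi c :
  wiener_bound phi c -> wiener_bound (fun z => \val z ^ m * phi z) c.
Proof.
move=> [cp pc]; split=> [|s us].
  exact: (ccontinuousM (ccontinuous_exprz m) cp).
have := pc [seq n - m | n <- s]; rewrite big_map (map_inj_uniq (addIr _)) => /(_ us).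
by under eq_bigr do rewrite -fourier_shift.
Qed.

Lemma wiener_bound_exprz (m : int) : wiener_bound (fun z => \val z ^ m) 1.
Proof.
split=> [|s us]; first exact: ccontinuous_exprz.
rewrite (eq_bigr (fun n => if n == m then 1 else 0)) => [|n _]; last first.
  by rewrite fourier_exprz; case: eqP; rewrite ?Normc.normc1 ?Normc.normc0.
rewrite -big_mkcond /= big_const_seq iter_addr_0 /= -[X in _ <= X]/(1%:R) ler_nat.
by rewrite (count_uniq_mem m us) leq_b1.
Qed.

Section SumsFourier.
Variables (phi_ : nat -> cfun) (c_ : nat -> R) (Phi : cfun) (M : R).
Hypotheses (phic : forall k, wiener_bound (phi_ k) (c_ k))
  (cM : forall N, \sum_(k < N) c_ k <= M) (sP : forall z, sums (phi_ ^~ z) (Phi z)).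

Let pc k z : nc (phi_ k z) <= c_ k. Proof. exact: wiener_bound_ev. Qed.
Let cp k : ccontinuous (phi_ k) := (phic k).1.

Let cPhi : ccontinuous Phi.
Proof. exact: (ccontinuous_sums cp pc cM sP). Qed.

(** The Fourier coefficients of a uniformly convergent series are approximated,
    uniformly in the index, by those of its partial sums. *)
Lemma fourier_approx e : 0 < e -> exists K, forall n,
  nc (fourier Phi n - \sum_(k < K) fourier (phi_ k) n) <= e.
Proof.
move=> e0; have e2 : 0 < e / 2 by rewrite divr_gt0.
have [K KP] := sums_uniform pc cM sP e2; exists K => n.
have cS : ccontinuous (fun z => \sum_(k < K) phi_ k z) by apply: ccontinuous_sum.
rewrite -fourier_sum // -fourierB //.
apply: le_trans (normc_fourier_le n _ KP) _; last by lra.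
have := ccontinuousD cPhi (ccontinuousZ (-1) cS).
by apply: ccontinuous_ext => z; rewrite mulN1r.
Qed.

(** Completeness of the Wiener algebra. *)
Lemma wiener_bound_sums : wiener_bound Phi M.
Proof.
split=> // s us; apply/ler_addgt0Pr => e e0.
have t0 : 0 < (size s).+1%:R :> R by rewrite ltr0n.
have [K KP] := fourier_approx (divr_gt0 e0 t0).
apply: (@le_trans _ _ (\sum_(n <- s) (\sum_(k < K) nc (fourier (phi_ k) n) + e / (size
  s).+1%:R))).
  apply: ler_sum => n _.
  rewrite -(subrK (\sum_(k < K) fourier (phi_ k) n) (fourier Phi n)) addrC.
  by apply: le_trans (normcD _ _) _; apply: lerD (KP n); exact: normc_sum.
rewrite big_split exchange_big; apply: lerD.
  by apply: le_trans (cM K); apply: ler_sum => k _; exact: (phic k).2.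
rewrite big_const_seq iter_addr_0 count_predT -[_ *+ _]mulr_natr mulrAC ler_pdivrMr //.
by rewrite ler_wpM2l ?(ltW e0) // ler_nat.
Qed.

Lemma fourier_sums n : sums (fun k => fourier (phi_ k) n) (fourier Phi n).
Proof.
apply/sumsP => e e0; have e4 : 0 < e / 4 by rewrite divr_gt0.
have c0 k : 0 <= c_ k := wiener_bound_ge0 (phic k).
have [K KP] := bounded_tail c0 cM e4.
have cS L : ccontinuous (fun z => \sum_(k < L) phi_ k z) by apply: ccontinuous_sum.
exists K => N KN; rewrite -fourier_sum // normc_distC -(fourierB _ cPhi (cS N)).
apply: (@le_lt_trans _ _ (2 * (e / 4))); last by lra.
apply: normc_fourier_le.
  have := ccontinuousD cPhi (ccontinuousZ (-1) (cS N)).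
  by apply: ccontinuous_ext => z; rewrite mulN1r.
move=> z; apply: (@sums_normc_le _ (fun k => phi_ (N + k)%N z)).
  2: exact: (sums_shift _ (@sP z)).
move=> L; apply: le_trans (ltW (KP (N - K + L)%N)); rewrite big_split_ord /=.
apply: ler_wpDl; first by apply: sumr_ge0.
by apply: ler_sum => k _; rewrite addnA subnKC.
Qed.

End SumsFourier.

(** A bijective enumeration of the integers, turning Fourier series into ordinary
    series. *)
Definition int_enum (j : nat) : int := if odd j then Negz j./2 else Posz j./2.

Lemma int_enum_inj : injective int_enum.
Proof.
move=> a b; rewrite /int_enum; case oa : (odd a); case ob : (odd b) => // -[] h;
by rewrite -(odd_double_half a) -(odd_double_half b) oa ob h.
Qed.

Lemma int_enum_surj n : exists j, int_enum j = n.
Proof.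
case: n => k; [exists k.*2 | exists k.*2.+1]; rewrite /int_enum /= ?odd_double /=.
  by rewrite doubleK.
by rewrite uphalf_double.
Qed.

Lemma wiener_bound_enum phi c N : wiener_bound phi c ->
  \sum_(j < N) nc (fourier phi (int_enum j)) <= c.
Proof.
move=> [_ /(_ [seq int_enum j | j <- iota 0 N])].
rewrite (map_inj_uniq int_enum_inj) iota_uniq => /(_ isT).
by rewrite big_map -[N in iota 0 N]subn0 -/(index_iota 0 N) big_mkord.
Qed.

Definition fourier_term phi (j : nat) : cfun :=
  fun z => fourier phi (int_enum j) * \val z ^ int_enum j.

Lemma fourier_term_bound phi j :
  wiener_bound (fourier_term phi j) (nc (fourier phi (int_enum j))).
Proof. by have := wiener_boundZ (fourier phi (int_enum j)) (wiener_bound_exprz (int_enum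
  j)); rewrite mulr1. Qed.

(** A function in the Wiener algebra is the sum of its Fourier series: the
    difference has no nonzero coefficient, so vanishes by wiener_bound_ev. *)
Lemma fourier_inversion phi c z : wiener_bound phi c ->
  sums (fourier_term phi ^~ z) (phi z).
Proof.
move=> np; have cb N := wiener_bound_enum N np.
have ex w : exists l, sums (fourier_term phi ^~ w) l.
  apply: (@abs_sums _ _ c) => N; apply: le_trans (cb N); apply: ler_sum => j _.
  by rewrite Normc.normcM normc_circle_exprz mulr1.
have [Psi PsiP] := choice ex.
have nPsi := wiener_bound_sums (fourier_term_bound phi) cb PsiP.
have fPsi n : fourier Psi n = fourier phi n.
  have s1 := fourier_sums (n := n) (fourier_term_bound phi) cb PsiP.
  have [j jn] := int_enum_surj n.
  have term k : fourier (fourier_term phi k) n = fourier phi (int_enum k) * (k == j)%:R.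
    rewrite fourierZ; last exact: ccontinuous_exprz.
    by rewrite fourier_exprz -jn (inj_eq int_enum_inj) eq_sym.
  have s2 : sums (fun k => fourier (fourier_term phi k) n) (\sum_(k < j.+1) fourier
    (fourier_term phi k) n).
    by apply: sums_finite => k jk; rewrite term gtn_eqF // mulr0.
  rewrite (sums_unique s1 s2) big_ord_recr /= big1 => [|k _].
    by rewrite term eqxx mulr1 add0r jn.
  by rewrite term ltn_eqF // mulr0.
have nd : wiener_bound (fun w => phi w - Psi w) 0.
  split=> [|s us].
    have := ccontinuousD np.1 (ccontinuousZ (-1) nPsi.1).
    by apply: ccontinuous_ext => w; rewrite mulN1r.
  rewrite big1 // => n _; rewrite fourierB ?fPsi ?subrr ?Normc.normc0 //.
    exact: np.1.
  exact: nPsi.1.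
have : phi z - Psi z = 0.
  apply: Normc.eq0_normc; apply/eqP; rewrite eq_le normc_ge0 andbT.
  exact: (wiener_bound_ev z nd).
by move/eqP; rewrite subr_eq0 => /eqP ->.
Qed.

Arguments fourier_inversion [phi c] z _.

(** Closure under products and under composition with a power map follows from
    completeness, by expanding one factor in its Fourier series. *)
Lemma wiener_bound_coef_norm : coef_norm wiener_bound.
Proof.
have Mbound (f : nat -> R) c d : 0 <= d -> (forall N, \sum_(k < N) f k <= c) ->
    forall N, \sum_(k < N) f k * d <= c * d.
  by move=> d0 fc N; rewrite -mulr_suml ler_wpM2r.
split.
- by move=> phi c [].
- by move=> phi c np z; exact: wiener_bound_ev.
- exact: wiener_bound_le.
- exact: wiener_boundD.
- exact: wiener_boundZ.
- move=> phi psi c d np nq.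
  have nt j := wiener_boundZ (fourier phi (int_enum j)) (wiener_bound_shift (int_enum j)
    nq).
  have cb := Mbound (fun j => nc (fourier phi (int_enum j))) _ _ (wiener_bound_ge0 nq)
    (fun N => wiener_bound_enum N np).
  apply: (wiener_bound_sums nt cb) => z.
  have := sumsZ (psi z) (fourier_inversion z np); rewrite mulrC.
  by congr sums; apply/funext => j; rewrite /fourier_term mulrC mulrA.
- move=> phi c n np.
  have nt j := wiener_boundZ (fourier phi (int_enum j)) (wiener_bound_exprz (n%:Z *
    int_enum j)).
  have cb := Mbound (fun j => nc (fourier phi (int_enum j))) _ _ ler01 (fun N =>
    wiener_bound_enum N np).
  rewrite -[c]mulr1; apply: (wiener_bound_sums nt cb) => z.
  have := fourier_inversion (cpow z n) np.
  by congr sums; apply/funext => j; rewrite /fourier_term -exprz_exp.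
- exact: wiener_bound_exprz.
- by move=> phi_ c_ Phi M h cM sP; exact: (wiener_bound_sums h cM sP).
Qed.

(** Bounded characters of the Wiener algebra are evaluations, by density of the
    trigonometric polynomials. *)
Lemma wiener_bound_char lam q phi c :
  bounded_char wiener_bound lam q -> wiener_bound phi c -> lam phi = phi q.
Proof.
move=> lamP np; have nbP := wiener_bound_coef_norm.
have cb N := wiener_bound_enum N np.
apply/eqP; rewrite -subr_eq0; apply/eqP/Normc.eq0_normc/eqP.
rewrite eq_le normc_ge0 andbT; apply/ler_addgt0Pr => e e0; rewrite add0r.
have e2 : 0 < e / 2 by rewrite divr_gt0.
have c0 j : 0 <= nc (fourier phi (int_enum j)) by exact: normc_ge0.
have [K KP] := bounded_tail c0 cb e2.
pose P z := \sum_(j < K) fourier_term phi j z.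
have nP : wiener_bound P (\sum_(j < K) nc (fourier phi (int_enum j))).
  by apply: (nb_sum nbP) => j _; exact: fourier_term_bound.
have lamterm j : lam (fourier_term phi j) = fourier_term phi j q.
  by rewrite (charZ lamP _ (wiener_bound_exprz _)) (char_exprz nbP lamP).
have lamPq : lam P = P q.
  rewrite /P (char_sum nbP lamP _ (fun j : 'I_K => fourier_term_bound phi j)).
  by apply: eq_bigr => j _; exact: lamterm.
have nr : wiener_bound (fun z => phi z - P z) (e / 2).
  apply: (@wiener_bound_sums (fun k => fourier_term phi (K + k)%N)
    (fun k => nc (fourier phi (int_enum (K + k)%N)))).
  - by move=> k; exact: fourier_term_bound.
  - by move=> N; exact: ltW.
  - by move=> z; exact: (sums_shift _ (fourier_inversion z np)).
have -> : lam phi - phi q = lam (fun z => phi z - P z) - (phi q - P q).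
  by rewrite (charB nbP lamP np nP) lamPq; ring.
apply: le_trans (normcD _ _) _; rewrite normcNE (splitr e).
by apply: lerD; [exact: (char_le lamP) | exact: (wiener_bound_ev q nr)].
Qed.

End Wiener.

(** * The two algebras as instances of one construction *)

Section AlgebraSets.
Variable R : realType.
Local Notation nc := (@Normc.normc R).
Local Notation cfun := (circle R -> R[i]).

(** The series whose coefficients have summable norms. *)
Definition nb_alg (nb : cfun -> R -> Prop) : set (fseries R) :=
  [set a | exists2 c : nat -> R, forall m, nb (a m) (c m) &
           exists M, forall N, \sum_(m < N) c m <= M].

(** Finiteness of the sum of the norms forces that of each norm, so only the
    continuity of the coefficients has to be required separately. *)
Lemma nb_algE (nb : cfun -> R -> Prop) (N : cfun -> \bar R) :
  (forall phi, (0 <= N phi)%E) ->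
  (forall phi c, nb phi c <-> ccontinuous phi /\ (N phi <= c%:E)%E) ->
  nb_alg nb = [set a | (forall m, ccontinuous (a m)) /\ (\sum_(m <oo) N (a m) < +oo)%E].
Proof.
move=> N0 nbP; apply/seteqP; split=> a /=.
  move=> [c nbc [M cM]]; split=> [m|]; first by have /nbP[] := nbc m.
  apply: (@le_lt_trans _ _ M%:E); last exact: ltry.
  apply: lime_le; first by apply: is_cvg_nneseries => n _ _.
  apply: nearW => n; rewrite big_mkord.
  apply: (@le_trans _ _ (\sum_(m < n) (c m)%:E)%E); last by rewrite sumEFin lee_fin.
  by apply: lee_sum => m _; have /nbP[] := nbc m.
move=> [ca Na]; pose c m := fine (N (a m)).
have Nfin m : (N (a m)) = (c m)%:E.
  rewrite /c fineK // ge0_fin_numE //; apply: le_lt_trans Na.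
  have := @nneseries_lim_ge _ (fun m => N (a m)) xpredT 0 m.+1 (fun n _ _ => N0 _).
  by apply: le_trans; rewrite big_mkord big_ord_recr /= leeDr // sume_ge0.
exists c; first by move=> m; apply/nbP; rewrite Nfin.
have S0 : (0 <= \sum_(m <oo) N (a m))%E by apply: nneseries_ge0.
exists (fine (\sum_(m <oo) N (a m))%E) => n.
rewrite -lee_fin fineK ?ge0_fin_numE // -sumEFin.
have := @nneseries_lim_ge _ (fun m => N (a m)) xpredT 0 n (fun n _ _ => N0 _).
by rewrite big_mkord; under eq_bigr do rewrite Nfin.
Qed.

Lemma wiener_boundP (phi : cfun) c :
  wiener_bound phi c <-> ccontinuous phi /\ (wiener_norm phi <= c%:E)%E.
Proof.
split=> [[cp pc]|[cp pc]]; split=> //.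
  apply: ge_ereal_sup => _ [A [fA _] <-].
  rewrite fsbig_finite //= sumEFin lee_fin.
  exact/pc/finmap.fset_uniq.
move=> s us; rewrite -lee_fin -sumEFin; apply: (le_trans _ pc).
apply: ereal_sup_ubound; exists [set` s]; first by split; [exact: finite_seq | by []].
by rewrite [RHS](fsbig_seq _ _ us).
Qed.

Lemma wiener_norm_ge0 (phi : cfun) : (0 <= wiener_norm phi)%E.
Proof. by apply: esum_ge0 => n _; rewrite lee_fin normc_ge0. Qed.

Lemma sup_boundP (phi : cfun) c :
  sup_bound phi c <-> ccontinuous phi /\ (sup_norm phi <= c%:E)%E.
Proof.
split=> [[cp pc]|[cp pc]]; split=> //.
  by apply: ge_ereal_sup => _ [z _ <-]; rewrite lee_fin.
by move=> z; rewrite -lee_fin; apply: (le_trans _ pc); apply: ereal_sup_ubound; exists z.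
Qed.

Lemma sup_norm_ge0 (phi : cfun) : (0 <= sup_norm phi)%E.
Proof.
apply: (@le_trans _ _ (nc (phi (expi 0)))%:E); first by rewrite lee_fin normc_ge0.
by apply: ereal_sup_ubound; exists (expi 0).
Qed.

Lemma algA_nb_alg : algA R = nb_alg (@wiener_bound R).
Proof.
rewrite (nb_algE wiener_norm_ge0 wiener_boundP); apply/seteqP; split=> a [ca Na]; split=>
  //.
  by move=> m; apply/ccontinuousP; case: (ca m).
move=> m; split; first exact/ccontinuousP.
apply: le_lt_trans Na.
have := @nneseries_lim_ge _ (fun m => wiener_norm (a m)) xpredT 0 m.+1 (fun n _ _ =>
  wiener_norm_ge0 _).
by apply: le_trans; rewrite big_mkord big_ord_recr leeDr // sume_ge0 // => i _; exact:
  wiener_norm_ge0.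
Qed.

Lemma algB_nb_alg : algB R = nb_alg (@sup_bound R).
Proof.
rewrite (nb_algE sup_norm_ge0 sup_boundP).
by apply/seteqP; split=> a [ca Na]; split=> // m; apply/ccontinuousP.
Qed.

End AlgebraSets.

(** * Algebras of formal series *)

Section SeriesAlgebra.
Variable R : realType.
Local Notation nc := (@Normc.normc R).
Local Notation cfun := (circle R -> R[i]).
Implicit Types (phi psi : cfun) (a b : fseries R) (c d : nat -> R) (z : circle R).

(** The Cauchy product of two real sequences; it bounds the norms of the
    coefficients of a product of series. *)
Definition cauchy c d p : R := \sum_(m < p.+1) c m * d (p - m)%N.

Lemma cauchy_sum_le c d M N :
  (forall m, 0 <= c m) -> (forall m, 0 <= d m) ->
  (forall P, \sum_(m < P) c m <= M) -> (forall P, \sum_(m < P) d m <= N) ->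
  forall P, \sum_(p < P) cauchy c d p <= M * N.
Proof.
move=> c0 d0 cM dN P.
have tail (m Q : nat) : (m <= Q)%N ->
    \sum_(p < Q | (m <= p)%N) d (p - m)%N = \sum_(p < Q - m) d p.
  move=> mQ; rewrite -[in LHS](subnKC mQ) big_mkcond big_split_ord /= big1 ?add0r => [|p _].
    by apply: eq_bigr => p _; rewrite leq_addr addKn.
  by rewrite leqNgt ltn_ord.
have -> : \sum_(p < P) cauchy c d p =
    \sum_(m < P) \sum_(p < P | (m <= p)%N) c m * d (p - m)%N.
  rewrite (eq_bigr (fun p : 'I_P => \sum_(m < P | (m <= p)%N) c m * d (p - m)%N)).
    by rewrite (exchange_big_dep xpredT).
  by move=> p _; rewrite /cauchy (big_ord_widen P (fun m => c m * d (p - m)%N)).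
apply: (@le_trans _ _ (\sum_(m < P) c m * N)); last first.
  by rewrite -mulr_suml ler_wpM2r //; have := dN 0%N; rewrite big_ord0.
apply: ler_sum => m _; rewrite -mulr_sumr ler_wpM2l //.
apply: le_trans (dN (P - m)%N).
by rewrite tail // ltnW.
Qed.

Lemma fseriesDE a b p z : (a + b) p z = a p z + b p z.
Proof. by []. Qed.

Lemma smulDl a a' b : smul (a + a') b = smul a b + smul a' b.
Proof.
apply/funext => p; apply/funext => z; rewrite fseriesDE /smul -big_split.
by apply: eq_bigr => m _; exact: mulrDl.
Qed.

Lemma smulDr a b b' : smul a (b + b') = smul a b + smul a b'.
Proof.
apply/funext => p; apply/funext => z; rewrite fseriesDE /smul -big_split.
by apply: eq_bigr => m _; exact: mulrDr.
Qed.

(** The unit of the algebra of series. *)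
Definition sone : fseries R := monomial 0 (fun=> 1).

Lemma smul1l a : smul sone a = a.
Proof.
apply/funext => p; apply/funext => z; rewrite /smul big_ord_recl /= subn0.
by rewrite /sone /monomial /= mul1r big1 ?addr0 // => m _; rewrite mul0r.
Qed.

Lemma smul1r a : smul a sone = a.
Proof.
apply/funext => p; apply/funext => z; rewrite /smul big_ord_recr /= subnn.
rewrite /sone /monomial /= mulr1 big1 ?add0r.
  by congr (a p _); apply: circle_inj; rewrite /= expr1.
by move=> m _; rewrite subn_eq0 leqNgt ltn_ord /= mulr0.
Qed.

Lemma smulX_succ a p z : smul (gen_x R) a p.+1 z = a p z.
Proof.
rewrite /smul big_ord_recl big_ord_recl big1 => [|m _]; last by rewrite /gen_x /monomial
  /= mul0r.
by rewrite /gen_x /monomial /= mul0r mul1r add0r addr0 subSS subn0.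
Qed.

Lemma smulX0 a z : smul (gen_x R) a 0 z = 0.
Proof. by rewrite /smul big_ord_recl big_ord0 /gen_x /monomial /= mul0r addr0. Qed.

(** The quotient a' in the decomposition a = a_0 + x a'. *)
Definition sshift a : fseries R := fun m => a m.+1.

Lemma series_split a : a = monomial 0 (a 0%N) + smul (gen_x R) (sshift a).
Proof.
apply/funext => -[|p]; apply/funext => z; rewrite fseriesDE.
  by rewrite smulX0 /monomial /= addr0.
by rewrite smulX_succ /monomial /= add0r.
Qed.

(** The polynomial in x formed by the first P terms of a. *)
Definition strunc (P : nat) a : fseries R := \sum_(m < P) monomial m (a m).

Lemma fseries_sumE (I : Type) (r : seq I) (Q : pred I) (F : I -> fseries R) m z :
  (\sum_(i <- r | Q i) F i) m z = \sum_(i <- r | Q i) F i m z.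
Proof. by elim/big_rec2: _ => // i u v _ <-. Qed.

Lemma struncE P a m z : strunc P a m z = if (m < P)%N then a m z else 0.
Proof.
rewrite /strunc fseries_sumE /monomial; case: ltnP => mP.
  rewrite (bigD1 (Ordinal mP)) //= eqxx big1 ?addr0 // => i im.
  by rewrite eq_sym (_ : (i == m :> nat) = false) //; apply/negbTE.
by rewrite big1 // => i _; rewrite gtn_eqF // (leq_trans _ mP).
Qed.

Section Norm.
Variables (nb : cfun -> R -> Prop) (nbP : coef_norm nb).

(** The norm of the series a is at most M. *)
Definition sbound a M : Prop :=
  exists2 c, forall m, nb (a m) (c m) & forall N, \sum_(m < N) c m <= M.

Lemma nb_algP a : nb_alg nb a <-> exists M, sbound a M.
Proof. by split=> [[c ca [M cM]]|[M [c ca cM]]]; [exists M, c | exists c => //; exists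
  M]. Qed.

Lemma sbound_alg a M : sbound a M -> nb_alg nb a.
Proof. by move=> h; apply/nb_algP; exists M. Qed.

Lemma sbound_ge0 a M : sbound a M -> 0 <= M.
Proof. by move=> [c _ /(_ 0%N)]; rewrite big_ord0. Qed.

Lemma sbound_le a M N : sbound a M -> M <= N -> sbound a N.
Proof. by move=> [c ca cM] MN; exists c => // P; apply: le_trans MN. Qed.

Lemma sboundD a b M N : sbound a M -> sbound b N -> sbound (a + b) (M + N).
Proof.
move=> [c ca cM] [d db dN]; exists (fun m => c m + d m) => [m|P].
  exact: (nbD nbP).
by rewrite big_split; exact: lerD.
Qed.

Lemma sboundZ (k : R[i]) a M : sbound a M -> sbound (k *: a) (nc k * M).
Proof.
move=> [c ca cM]; exists (fun m => nc k * c m) => [m|P].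
  exact: (nbZ nbP).
by rewrite -mulr_sumr ler_wpM2l ?normc_ge0.
Qed.

Lemma sbound_monomial m phi (c : R) : nb phi c -> sbound (monomial m phi) c.
Proof.
move=> pc; exists (fun p => if p == m then c else 0) => [p|P].
  rewrite /monomial; case: eqP => _ //.
  exact: (nb0 nbP).
have [mP|Pm] := ltnP m P.
  by rewrite (bigD1 (Ordinal mP)) //= eqxx big1 ?addr0 // => i /negbTE im; rewrite ifF.
rewrite big1 => [|i _]; first exact: (nb_ge0 nbP pc).
by rewrite ltn_eqF // (leq_trans _ Pm).
Qed.

Lemma sbound0 : sbound 0 0.
Proof.
exists (fun=> 0) => [m|P]; first exact: (nb0 nbP).
by rewrite big1.
Qed.

Lemma nb_smul a b c d : (forall m, nb (a m) (c m)) -> (forall m, nb (b m) (d m)) ->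
  forall p, nb (smul a b p) (cauchy c d p).
Proof.
move=> ca db p; apply: (nb_sum nbP) => m _.
exact: (nbM nbP (nb_cpow nbP _ (ca _)) (db _)).
Qed.

Lemma sbound_smul a b M N : sbound a M -> sbound b N -> sbound (smul a b) (M * N).
Proof.
move=> [c ca cM] [d db dN]; exists (cauchy c d); first exact: nb_smul.
by apply: cauchy_sum_le => // m; [apply: (nb_ge0 nbP (ca m)) | apply: (nb_ge0 nbP (db m))].
Qed.

Lemma alg0 : nb_alg nb 0. Proof. exact: sbound_alg sbound0. Qed.

Lemma algD a b : nb_alg nb a -> nb_alg nb b -> nb_alg nb (a + b).
Proof.
move=> /nb_algP[M aM] /nb_algP[N bN]; exact: sbound_alg (sboundD aM bN).
Qed.

Lemma algZ (k : R[i]) a : nb_alg nb a -> nb_alg nb (k *: a).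
Proof. by move=> /nb_algP[M aM]; exact: sbound_alg (sboundZ k aM). Qed.

Lemma algM a b : nb_alg nb a -> nb_alg nb b -> nb_alg nb (smul a b).
Proof.
move=> /nb_algP[M aM] /nb_algP[N bN]; exact: sbound_alg (sbound_smul aM bN).
Qed.

Lemma alg_monomial m phi (c : R) : nb phi c -> nb_alg nb (monomial m phi).
Proof. by move=> pc; exact: sbound_alg (sbound_monomial m pc). Qed.

Lemma alg_coef a m : nb_alg nb a -> exists r, nb (a m) r.
Proof. by move=> [c ca _]; exists (c m). Qed.

Lemma alg_sum (I : Type) (r : seq I) (Q : pred I) (F : I -> fseries R) :
  (forall i, Q i -> nb_alg nb (F i)) -> nb_alg nb (\sum_(i <- r | Q i) F i).
Proof. by move=> h; apply: big_ind => //; [exact: alg0 | exact: algD]. Qed.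

Lemma alg_strunc P a : nb_alg nb a -> nb_alg nb (strunc P a).
Proof.
move=> aa; apply: alg_sum => m _; have [c ca] := alg_coef m aa.
exact: alg_monomial ca.
Qed.

Lemma alg_sshift a : nb_alg nb a -> nb_alg nb (sshift a).
Proof.
move=> [c ca [M cM]]; exists (fun m => c m.+1) => [m|]; first exact: ca.
exists M => N; apply: le_trans (cM N.+1); rewrite big_ord_recl lerDr.
exact: (nb_ge0 nbP (ca 0%N)).
Qed.

Lemma sone_bound : sbound sone 1.
Proof. exact: sbound_monomial (nb1 nbP). Qed.

Lemma alg_sone : nb_alg nb sone.
Proof. exact: sbound_alg sone_bound. Qed.

Lemma alg_x : nb_alg nb (gen_x R).
Proof. exact: alg_monomial (nb1 nbP). Qed.

(** Density of the polynomials in x. *)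
Lemma strunc_approx a (e : R) : nb_alg nb a -> 0 < e ->
  exists P, sbound (a - strunc P a) e.
Proof.
move=> [c ca [M cM]] e0; have c0 m : 0 <= c m := nb_ge0 nbP (ca m).
have [P PP] := bounded_tail c0 cM e0; exists P.
exists (fun m => if (m < P)%N then 0 else c m) => [m|N].
  have E z : a m z - strunc P a m z = if (m < P)%N then 0 else a m z.
    by rewrite struncE; case: ltnP => _; rewrite ?subrr ?subr0.
  case: ltnP => mP.
    by apply: nb_ext (nb0 nbP) => z; rewrite [RHS]E mP.
  by apply: nb_ext (ca m) => z; rewrite [RHS]E ltnNge mP.
have [NP|PN] := leqP N P.
  by rewrite big1 ?(ltW e0) // => m _; rewrite (leq_trans (ltn_ord m) NP).
apply: le_trans (ltW (PP (N - P)%N)); rewrite -[in leLHS](subnKC (ltnW PN)) big_split_ord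
  /=.
rewrite big1 ?add0r => [|m _]; last by rewrite ltn_ord.
by apply: ler_sum => m _; rewrite ltnNge leq_addr.
Qed.

(** The Neumann series of a series a of norm at most r < 1.  The coefficient of
    x^p in the k-th power of a is bounded by cpw k p, whose sum over p is at most
    r ^ k; the norm of the coefficient of x^p in the Neumann series is then bounded
    by D p, the supremum over K of the partial sums S p K. *)
Section Neumann.
Variables (a : fseries R) (c : nat -> R) (r : R).
Hypotheses (ca : forall m, nb (a m) (c m)) (cr : forall N, \sum_(m < N) c m <= r)
  (r1 : r < 1).

Let apow k : fseries R := iter k (smul a) sone.
Let cpw k : nat -> R := iter k (cauchy c) (fun m => (m == 0%N)%:R).

Let apow_bound k m : nb (apow k m) (cpw k m).
Proof.
elim: k m => [|k IH] m; last exact: nb_smul.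
rewrite /apow /cpw /= /sone /monomial; case: eqP => _; [exact: nb1 | exact: nb0].
Qed.

Let cpw_ge0 k m : 0 <= cpw k m. Proof. exact: (nb_ge0 nbP (apow_bound k m)). Qed.
Let r_ge0 : 0 <= r. Proof. by have := cr 0; rewrite big_ord0. Qed.

Let cpw_sum k P : \sum_(m < P) cpw k m <= r ^+ k.
Proof.
elim: k P => [|k IH] P.
  case: P => [|P]; first by rewrite big_ord0 expr0.
  by rewrite big_ord_recl big1 //= addr0 expr0.
rewrite exprS; apply: cauchy_sum_le => // m.
exact: (nb_ge0 nbP (ca m)).
Qed.

Let C : R := (1 - r)^-1.

Let S p K : R := \sum_(k < K) cpw k p.

Let S_sum P K : \sum_(p < P) S p K <= C.
Proof.
rewrite exchange_big /=; apply: (@le_trans _ _ (\sum_(k < K) r ^+ k)).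
  by apply: ler_sum => k _; exact: cpw_sum.
rewrite /C -[leRHS]mul1r ler_pdivlMr ?subr_gt0 // mulrC -[_ * _]opprK -mulNr opprB.
by rewrite -subrX1 opprB gerBl exprn_ge0.
Qed.

Let S_mono p K L : (K <= L)%N -> S p K <= S p L.
Proof.
move=> KL; rewrite /S -[L](subnKC KL) big_split_ord /= lerDl.
by apply: sumr_ge0 => k _.
Qed.

Let S_le p K : S p K <= C.
Proof.
apply: le_trans (S_sum p.+1 K); rewrite big_ord_recr /= lerDr.
by apply: sumr_ge0 => q _; apply: sumr_ge0.
Qed.

Let D p : R := sup (range (S p)).

Let S_sup p : has_sup (range (S p)).
Proof. by split; [exists (S p 0), 0 | exists C => _ [K _ <-]]. Qed.

Let D_approx P e : 0 < e -> exists K, \sum_(p < P) D p <= \sum_(p < P) S p K + e.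
Proof.
elim: P e => [|P IH] e e0.
  by exists 0; rewrite !big_ord0 add0r ltW.
have e2 : 0 < e / 2 by rewrite divr_gt0.
have [K1 h1] := IH _ e2; have [_ [K2 _ <-] h2] := sup_adherent e2 (S_sup P).
exists (maxn K1 K2); rewrite !big_ord_recr /= (splitr e) addrACA; apply: lerD.
  apply: le_trans h1 _; rewrite lerD2r; apply: ler_sum => p _.
  by apply: S_mono; exact: leq_maxl.
rewrite -lerBlDr; apply: le_trans (ltW h2) _.
by apply: S_mono; exact: leq_maxr.
Qed.

Let D_sum P : \sum_(p < P) D p <= C.
Proof.
apply/ler_addgt0Pr => e /(D_approx P)[K h]; apply: le_trans h _.
by rewrite lerD2r.
Qed.

Lemma neumann_exists : exists2 b, nb_alg nb b & b = sone + smul a b.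
Proof.
have ex (pz : nat * circle R) : exists l, sums (fun k => apow k pz.1 pz.2) l.
  apply: (@abs_sums _ _ C) => N; apply: le_trans (S_le pz.1 N).
  by apply: ler_sum => k _; exact: (nb_ev nbP (apow_bound k pz.1)).
have [b0 b0P] := choice ex; pose b : fseries R := fun p z => b0 (p, z).
have bP p z : sums (fun k => apow k p z) (b p z) := b0P (p, z).
exists b.
  exists D; last by exists C.
  move=> p; apply: (nb_sums nbP (fun k => apow_bound k p)).
    by move=> K; apply: (ub_le_sup (S_sup p).2); exists K.
  by move=> z; exact: bP.
apply/funext => p; apply/funext => z; rewrite fseriesDE.
have h1 := sums_shift 1 (bP p z); rewrite big_ord_recl big_ord0 addr0 in h1.
apply/eqP; rewrite addrC -subr_eq; apply/eqP; apply: sums_unique h1 _.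
by apply: sums_sum => m _ _; apply: sumsZ; exact: bP.
Qed.

End Neumann.

Lemma neumann a r : sbound a r -> r < 1 ->
  exists2 b, nb_alg nb b & b = sone + smul a b.
Proof. by move=> [c ca cr] r1; exact: (neumann_exists ca cr r1). Qed.

End Norm.
End SeriesAlgebra.
Arguments sone R : clear implicits.

(** * The matrices of the listed representations *)

Section PiRep.
Variable R : realType.
Local Notation nc := (@Normc.normc R).
Local Notation cfun := (circle R -> R[i]).
Implicit Types (phi psi : cfun) (a b : fseries R) (z alpha : circle R).

Lemma cpowM z m n : cpow (cpow z m) n = cpow z (m * n).
Proof. by apply: circle_inj; rewrite /= exprM. Qed.

Lemma cpow_period k alpha n : cpow alpha (2 ^ k) = alpha ->
  cpow alpha (2 ^ (n %% k)) = cpow alpha (2 ^ n).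
Proof.
move=> ak; rewrite {2}(divn_eq n k) expnD -cpowM; congr (cpow _ _).
elim: (n %/ k)%N => [|l IH]; first by apply: circle_inj; rewrite /= mul0n expr1.
by rewrite mulSn expnD -cpowM ak.
Qed.

(** Cyclic form of the matrix X: the column j has its entry 1 in row j + 1
    modulo k. *)
Lemma shift_mxE k (i j : 'I_k) : shift_mx R k i j = (i == j.+1 %% k :> nat)%N%:R.
Proof.
rewrite mxE; congr (_%:R); case: k i j => [[]//|k] i j /=.
have [jk|jk] := eqVneq (j : nat) k.
  rewrite jk modnn andbT (_ : (i == k.+1 :> nat) = false) ?orbF //.
  by rewrite ltn_eqF // ltn_ord.
by rewrite andbF /= modn_small // ltnS ltn_neqAle jk -ltnS ltn_ord.
Qed.

Lemma shift_mxXE k m (i j : 'I_k) :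
  (shift_mx R k ^+ m) i j = (i == (j + m) %% k :> nat)%N%:R.
Proof.
elim: m i j => [|m IH] i j.
  by rewrite expr0 mxE addn0 modn_small // ltn_ord.
have k0 : (0 < k)%N by case: k i {j IH} => [[]|].
rewrite exprSr mxE (bigD1 (Ordinal (ltn_pmod j.+1 k0))) //= big1 => [|l lj].
  by rewrite IH shift_mxE eqxx mulr1 addr0 /= modnDml addSnnS.
rewrite shift_mxE (_ : (l == _ :> nat)%N = false) ?mulr0 //.
by apply/negbTE; apply: contra lj => /eqP lj; apply/eqP/val_inj.
Qed.

Lemma diag_ofE n k alpha phi (A : 'M[R[i]]_(n, k)) i j :
  (A *m diag_of k alpha phi) i j = A i j * phi (cpow alpha (2 ^ j)).
Proof. by rewrite /diag_of mul_mx_diag !mxE. Qed.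

Lemma diag_ofEl n k alpha phi (A : 'M[R[i]]_(k, n)) i j :
  (diag_of k alpha phi *m A) i j = phi (cpow alpha (2 ^ i)) * A i j.
Proof. by rewrite /diag_of mul_diag_mx !mxE. Qed.

(** The matrix form of the relation phi x = x phi(z^2). *)
Lemma diag_shift k alpha phi n : cpow alpha (2 ^ k) = alpha ->
  diag_of k alpha phi *m shift_mx R k ^+ n =
  shift_mx R k ^+ n *m diag_of k alpha (fun z => phi (cpow z (2 ^ n))).
Proof.
move=> ak; apply/matrixP => i j; rewrite diag_ofE diag_ofEl shift_mxXE.
case: eqP => [->|_]; last by rewrite mulr0 mul0r.
by rewrite mulr1 mul1r cpow_period // expnD cpowM.
Qed.

(** The m-th term of the series defining pi_rep. *)
Definition pi_term k alpha (gamma : R[i]) a (m : nat) : 'M[R[i]]_k :=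
  gamma ^+ m *: (shift_mx R k ^+ m *m diag_of k alpha (a m)).

Lemma pi_termE k alpha gamma a m (i j : 'I_k) : pi_term k alpha gamma a m i j =
  gamma ^+ m * ((i == (j + m) %% k :> nat)%N%:R * a m (cpow alpha (2 ^ j))).
Proof. by rewrite mxE diag_ofE shift_mxXE. Qed.

Section Norm.
Variables (nb : cfun -> R -> Prop) (nbP : coef_norm nb).
Variables (k : nat) (alpha : circle R) (gamma : R[i]).
Hypotheses (alphak : cpow alpha (2 ^ k) = alpha) (gamma1 : nc gamma <= 1).

Local Notation AA := (nb_alg nb).
Local Notation pi := (pi_rep k alpha gamma).

Lemma pi_term_le a c m i j : nb (a m) c -> nc (pi_term k alpha gamma a m i j) <= c.
Proof.
move=> ac; rewrite pi_termE !Normc.normcM normcX.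
have c0 := nb_ge0 nbP ac.
rewrite -[c]mul1r; apply: ler_pM; rewrite ?exprn_ge0 ?normc_ge0 ?mulr_ge0 ?normc_ge0 //.
  by rewrite exprn_ile1 // normc_ge0.
case: eqP => _; rewrite ?Normc.normc1 ?Normc.normc0 ?mul1r ?mul0r //.
exact: (nb_ev nbP ac).
Qed.

Lemma pi_sums a i j : AA a ->
  sums (fun m => pi_term k alpha gamma a m i j) (pi a i j).
Proof.
move=> [c ca [M cM]].
have [l sl] : exists l, sums (fun m => pi_term k alpha gamma a m i j) l.
  apply: (@abs_sums _ _ M) => N; apply: le_trans (cM N).
  by apply: ler_sum => m _; exact: pi_term_le.
by rewrite mxE (sums_limn sl).
Qed.

Arguments pi_sums [a] i j _.

Lemma pi_le a M i j : sbound nb a M -> nc (pi a i j) <= M.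
Proof.
move=> aM; have aa := sbound_alg aM; case: aM => c ca cM.
apply: sums_normc_le (pi_sums i j aa) => N; apply: le_trans (cM N).
by apply: ler_sum => m _; exact: pi_term_le.
Qed.

Lemma piD a b : AA a -> AA b -> pi (a + b) = pi a + pi b.
Proof.
move=> aa ab; apply/matrixP => i j; rewrite [RHS]mxE.
apply: sums_unique (pi_sums i j (algD nbP aa ab)) _.
have := sumsD (pi_sums i j aa) (pi_sums i j ab); congr sums.
by apply/funext => m; rewrite !pi_termE fseriesDE; ring.
Qed.

Lemma piZ (c : R[i]) a : AA a -> pi (c *: a) = c *: pi a.
Proof.
move=> aa; apply/matrixP => i j; rewrite [RHS]mxE.
apply: sums_unique (pi_sums i j (algZ nbP c aa)) _.
have := sumsZ c (pi_sums i j aa); congr sums.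
apply/funext => m; rewrite !pi_termE (_ : (c *: a) m _ = c * a m (cpow alpha (2 ^ j))) //.
by ring.
Qed.

Lemma piB a b : AA a -> AA b -> pi (a - b) = pi a - pi b.
Proof.
move=> aa ab; have aN := algZ nbP (-1) ab.
by rewrite -(scaleN1r b) piD // piZ // scaleN1r.
Qed.

Lemma pi0 : pi 0 = 0.
Proof. by rewrite -[X in pi X](subrr 0) piB ?subrr //; exact: (alg0 nbP). Qed.

Lemma pi_sum (I : Type) (r : seq I) (F : I -> fseries R) :
  (forall i, AA (F i)) -> pi (\sum_(i <- r) F i) = \sum_(i <- r) pi (F i).
Proof.
move=> h; elim: r => [|x r IH]; first by rewrite !big_nil pi0.
by rewrite !big_cons piD ?IH //; exact: (alg_sum nbP).
Qed.

Lemma pi_one : pi (sone R) = 1%:M.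
Proof.
rewrite /sone pi_rep_monomial expr0 scale1r expr0.
apply/matrixP => i j; rewrite diag_ofE mulr1; exact: erefl.
Qed.

Lemma piM_monomial m n phi psi :
  pi (smul (monomial m phi) (monomial n psi)) = pi (monomial m phi) *m pi (monomial n psi).
Proof.
rewrite smul_monomial !pi_rep_monomial -scalemxAl -scalemxAr scalerA -exprD; congr (_ *: _).
have -> : shift_mx R k ^+ (m + n) = shift_mx R k ^+ m *m shift_mx R k ^+ n by rewrite exprD.
rewrite -!mulmxA (mulmxA (diag_of _ _ phi)) diag_shift // -!mulmxA.
congr (_ *m _); congr (_ *m _); apply/matrixP => i j; rewrite diag_ofE /diag_of !mxE.
by case: eqP => [->|_]; rewrite ?mulr1n ?mulr0n ?mul0r.
Qed.

(** The defect pi (smul a b) - pi a *m pi b is bilinear, vanishes on polynomials in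
    x, and is bounded by a multiple of the product of the norms, so it vanishes by
    density. *)
Lemma piM a b : AA a -> AA b -> pi (smul a b) = pi a *m pi b.
Proof.
move=> aa ab.
pose F u v := pi (smul u v) - pi u *m pi v.
have FDl u u' v : AA u -> AA u' -> AA v -> F (u + u') v = F u v + F u' v.
  move=> hu hu' hv; rewrite /F smulDl (piD (algM nbP hu hv) (algM nbP hu' hv)) (piD hu
    hu') mulmxDl opprD.
  by rewrite addrACA.
have FDr u v v' : AA u -> AA v -> AA v' -> F u (v + v') = F u v + F u v'.
  move=> hu hv hv'; rewrite /F smulDr (piD (algM nbP hu hv) (algM nbP hu hv')) (piD hv
    hv') mulmxDr opprD.
  by rewrite addrACA.
have F0l v : AA v -> F 0 v = 0.
  by move=> hv; have := FDl 0 0 v (alg0 nbP) (alg0 nbP) hv; rewrite addr0 => /esym/eqP;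
    rewrite -subr_eq0 addrK => /eqP.
have F0r u : AA u -> F u 0 = 0.
  by move=> hu; have := FDr u 0 0 hu (alg0 nbP) (alg0 nbP); rewrite addr0 => /esym/eqP;
    rewrite -subr_eq0 addrK => /eqP.
have Ftrunc P Q : F (strunc P a) (strunc Q b) = 0.
  have am (m : nat) : AA (monomial m (a m)) by have [c cX] := alg_coef m aa; exact:
    (alg_monomial nbP _ cX).
  have bm (m : nat) : AA (monomial m (b m)) by have [c cX] := alg_coef m ab; exact:
    (alg_monomial nbP _ cX).
  rewrite /strunc; apply: (@proj2 (AA (\sum_(m < P) monomial m (a m)))).
  elim/big_ind: _ => [|u u' [hu Fu] [hu' Fu']|m _].
  - by split; [exact: (alg0 nbP) | apply: F0l; exact: (alg_strunc nbP)].
  - by split; [exact: (algD nbP) | rewrite FDl ?Fu ?Fu' ?addr0 //; exact: (alg_strunc nbP)].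
  split; first exact: am.
  apply: (@proj2 (AA (\sum_(n < Q) monomial n (b n)))).
  elim/big_ind: _ => [|v v' [hv Fv] [hv' Fv']|n _].
  - by split; [exact: (alg0 nbP) | exact: F0r].
  - by split; [exact: (algD nbP) | rewrite FDr ?Fv ?Fv' ?addr0].
  by split; [exact: bm | rewrite /F piM_monomial subrr].
have Fle u v M N i j : sbound nb u M -> sbound nb v N -> nc (F u v i j) <= (1 + k%:R) *
  (M * N).
  move=> uM vN.
  have -> : F u v i j = pi (smul u v) i j - \sum_l pi u i l * pi v l j.
    by rewrite /F mxE; congr (_ + _); rewrite mxE; congr (- _); rewrite mxE.
  rewrite mulrDl mul1r; apply: le_trans (normcD _ _) _; rewrite normcNE.
  apply: lerD; first exact: pi_le (sbound_smul nbP uM vN).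
  apply: le_trans (normc_sum _ _ _) _.
  apply: (@le_trans _ _ (\sum_(l < k) M * N)); last by rewrite sumr_const card_ord
    mulr_natl.
  apply: ler_sum => l _; rewrite Normc.normcM.
  by apply: ler_pM; rewrite ?normc_ge0 //; exact: pi_le.
apply/eqP; rewrite -subr_eq0 -/(F a b); clearbody F; apply/eqP/matrixP => i j; rewrite
  [RHS]mxE.
apply: Normc.eq0_normc; apply/eqP; rewrite eq_le normc_ge0 andbT.
apply/ler_addgt0Pr => e e0; rewrite add0r.
have /nb_algP[M aM] := aa; have /nb_algP[N bN] := ab.
have M0 := sbound_ge0 aM; have N0 := sbound_ge0 bN.
pose C := (1 + k%:R) * (M + 1 + N).
have C0 : 0 < C.
  by apply: mulr_gt0; [rewrite ltr_wpDr | rewrite ltr_wpDr // ltr_wpDl].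
pose d := Num.min 1 (e / C).
have d0 : 0 < d by rewrite lt_min ltr01 divr_gt0.
have d1 : d <= 1 by rewrite ge_min lexx.
have dC : C * d <= e by rewrite mulrC -ler_pdivlMr // ge_min lexx orbT.
have [P aP] := strunc_approx nbP aa d0; have [Q bQ] := strunc_approx nbP ab d0.
have hP := alg_strunc nbP P aa; have hQ := alg_strunc nbP Q ab.
have haP : AA (a - strunc P a) by exact: sbound_alg aP.
have hbQ : AA (b - strunc Q b) by exact: sbound_alg bQ.
have tb : sbound nb (strunc P a) (M + d).
  have := sboundD nbP aM (sboundZ nbP (-1) aP).
  by rewrite normcNE Normc.normc1 mul1r scaleN1r opprB addrC subrK.
have -> : F a b = F (strunc P a) (b - strunc Q b) + F (a - strunc P a) b.
  have -> : F a b = F (strunc P a) b + F (a - strunc P a) b.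
    by rewrite -(FDl _ _ _ hP haP ab) addrC subrK.
  congr (_ + _); rewrite -[X in F _ X = _](subrK (strunc Q b)) (FDr _ _ _ hP hbQ hQ).
  by rewrite Ftrunc addr0.
rewrite mxE; apply: le_trans (normcD _ _) _.
apply: le_trans (lerD (Fle _ _ _ _ i j tb bQ) (Fle _ _ _ _ i j aP bN)) _.
apply: le_trans dC; rewrite -mulrDr /C -mulrA ler_wpM2l ?addr_ge0 //.
have : d * d <= d by rewrite ler_piMr // ltW.
by nra.
Qed.

End Norm.
End PiRep.

(** * The listed representations are irreducible *)

Section PiIrreducible.
Variable R : realType.
Local Notation nc := (@Normc.normc R).
Local Notation cfun := (circle R -> R[i]).
Implicit Types (phi psi : cfun) (a b : fseries R) (z alpha : circle R).

Lemma normc_gt0_le1 (g : R[i]) : 0 < `|g| <= 1 -> 0 < nc g <= 1.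
Proof. by rewrite normc_norm ltcR lecR. Qed.

Lemma least_period_inj k alpha i j : least_period k alpha -> (i < k)%N -> (j < k)%N ->
  cpow alpha (2 ^ i) = cpow alpha (2 ^ j) -> i = j.
Proof.
move=> [k0 ak la] ik jk; wlog ij : i j ik jk / (i < j)%N.
  move=> W; have [ij|ji|->//] := ltngtP i j; first exact: W.
  by move=> e; apply/esym; apply: W.
move=> e; have := congr1 (fun z => cpow z (2 ^ (k - j))) e.
rewrite !cpowM -!expnD subnKC ?(ltnW jk) // ak => h; exfalso; apply: (la (i + (k - j))%N) h.
by lia.
Qed.

Lemma least_period_exists alpha k : (0 < k)%N -> cpow alpha (2 ^ k) = alpha ->
  exists j, least_period j alpha.
Proof.
move=> k0 ak; pose P j := (0 < j)%N && (cpow alpha (2 ^ j) == alpha).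
have exP : exists j, P j by exists k; rewrite /P k0 ak eqxx.
exists (ex_minn exP); case: ex_minnP => j /andP[j0 /eqP aj] jmin; split=> // l.
move=> /andP[l0 lj] al; have := jmin l; rewrite /P l0 al eqxx => /(_ isT).
by rewrite leqNgt lj.
Qed.

Section Norm.
Variables (nb : cfun -> R -> Prop) (nbP : coef_norm nb).
Local Notation AA := (nb_alg nb).

Lemma nb_prod_exists (I : Type) (r : seq I) (P : pred I) (F : I -> cfun) :
  (forall i, exists c, nb (F i) c) ->
  exists c, nb (fun z => \prod_(i <- r | P i) F i z) c.
Proof.
move=> h; elim: r => [|x r [c IH]].
  by exists 1; apply: nb_ext (nb1 nbP) => z; rewrite big_nil.
case Px : (P x); last first.
  by exists c; apply: nb_ext IH => z; rewrite big_cons Px.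
have [d xd] := h x; exists (d * c).
by apply: nb_ext (nbM nbP xd IH) => z; rewrite big_cons Px.
Qed.

(** Lagrange interpolation on the orbit of alpha. *)
Lemma orbit_separation k alpha (s : 'I_k) : least_period k alpha ->
  exists2 phi, exists c, nb phi c &
    forall j : 'I_k, phi (cpow alpha (2 ^ j)) = (s == j)%:R.
Proof.
move=> la; pose A (j : 'I_k) := \val (cpow alpha (2 ^ j)).
have Ainj i j : A i = A j -> i = j.
  by move=> /circle_inj/(least_period_inj la (ltn_ord i) (ltn_ord j))/val_inj.
pose F (l : 'I_k) : cfun := fun z => (A s - A l)^-1 * (\val z - A l).
exists (fun z => \prod_(l < k | l != s) F l z).
  apply: nb_prod_exists => l; eexists.
  exact: (nbZ nbP _ (nbB nbP (nb_val nbP) (nb_cst nbP (A l)))).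
move=> j; have [<-|sj] := eqVneq s j.
  apply: big1 => l ls; rewrite /F -/(A s) mulVf // subr_eq0.
  by apply: contra ls => /eqP/Ainj ->.
by rewrite (bigD1 j) /= ?[j == s]eq_sym // /F -/(A j) subrr mulr0 mul0r.
Qed.

Lemma pi_rep0_monomial k alpha gamma phi :
  pi_rep k alpha gamma (monomial 0 phi) = diag_of k alpha phi.
Proof. by rewrite pi_rep_monomial !expr0 scale1r mul1mx. Qed.

(** A nonzero invariant subspace contains a basis vector, by orbit_separation,
    hence all of them, by the powers of x. *)
Lemma pi_irreducible k alpha (gamma : R[i]) :
  least_period k alpha -> 0 < `|gamma| <= 1 ->
  irreducible_rep AA (pi_rep k alpha gamma).
Proof.
move=> la /normc_gt0_le1/andP[g0 g1]; have [k0 ak la'] := la.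
have gn0 : gamma != 0 by apply: contraTneq g0 => ->; rewrite Normc.normc0 ltxx.
split.
- split=> [a b aa ab|c a aa|a b aa ab].
  + exact: (piD nbP k alpha g1 aa ab).
  + exact: (piZ nbP k alpha g1 c aa).
  + exact: (piM nbP ak g1 aa ab).
- exists (sone R); first exact: (alg_sone nbP).
  rewrite (pi_one k alpha gamma) => /matrixP/(_ (Ordinal k0) (Ordinal k0)).
  by rewrite !mxE eqxx => /eqP; rewrite oner_eq0.
move=> U stU; have [->|U0] := eqVneq U 0; [by left | right].
have [r [s Urs]] : exists r s, U r s != 0.
  apply: contrapT => h; move/eqP: U0; apply; apply/matrixP => i j; rewrite [RHS]mxE.
  by apply/eqP; apply: contrapT => /negP Uij; apply: h; exists i, j.
have es : ((delta_mx 0 s : 'rV[R[i]]_k) <= U)%MS.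
  have [phi [c phic] phis] := orbit_separation s la.
  have st := stU _ (alg_monomial nbP 0 phic).
  rewrite pi_rep0_monomial in st.
  have rU : (row r U *m diag_of k alpha phi <= U)%MS.
    by apply: submx_trans st; apply: submxMr; exact: row_sub.
  have -> : delta_mx 0 s = (U r s)^-1 *: (row r U *m diag_of k alpha phi).
    apply/rowP => j; rewrite [LHS]mxE [RHS]mxE diag_ofE mxE phis eqxx /= eq_sym.
    by case: eqP => [<-|_]; rewrite ?mulr1 ?mulVf ?mulr0 // mulr0.
  exact: scalemx_sub.
rewrite -sub1mx; apply/row_subP => j; rewrite row1.
(* x^m sends the basis vector of index s to a multiple of that of index j, as
   s - m = j modulo k *)
pose m := (s + k - j)%N.
have st := stU _ (alg_monomial nbP m (nb1 nbP)).
rewrite pi_rep_monomial in st.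
have E : (delta_mx 0 s : 'rV[R[i]]_k) *m
    (gamma ^+ m *: (shift_mx R k ^+ m *m diag_of k alpha (fun=> 1))) =
    gamma ^+ m *: delta_mx 0 j.
  rewrite -scalemxAr mulmxA -rowE; congr (_ *: _).
  apply/rowP => l; rewrite diag_ofE mulr1 mxE shift_mxXE [RHS]mxE eqxx /=; congr (_%:R).
  have jl : (j <= s + k)%N by apply: leq_trans (ltnW (ltn_ord j)) (leq_addl _ _).
  have jm : (j + m = s + k)%N by rewrite /m subnKC.
  have -> : (s == (l + m) %% k :> nat)%N = (j + m == l + m %[mod k]).
    by rewrite jm modnDr (modn_small (ltn_ord s)).
  by rewrite eqn_modDr !modn_small // eq_sym.
have -> : delta_mx 0 j = (gamma ^+ m)^-1 *: (gamma ^+ m *: (delta_mx 0 j : 'rV[R[i]]_k)).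
  by rewrite scalerA mulVf ?expf_neq0 // scale1r.
rewrite -E; apply: scalemx_sub; apply: submx_trans st; exact: submxMr.
Qed.

(** The characters with chi(y) = 1 are the representations of dimension one
    among the pi_rep. *)
Lemma chi1_pi (p : R[i]) (q : circle R) : \val q = 1 ->
  (fun a => (chi p q a)%:M) = @pi_rep R 1 q p :> (fseries R -> 'M[R[i]]_1).
Proof.
move=> q1; apply/funext => a; apply/matrixP => i j; rewrite !ord1 [LHS]mxE mulr1n mxE.
rewrite /chi; congr (limn (series _)); apply/funext => m.
rewrite -/(pi_term 1 q p a m) pi_termE modn1 mul1r; congr (_ * a m _).
by apply: circle_inj; rewrite /= expr1.
Qed.

Lemma chi0E (q : circle R) a : chi 0 q a = a 0%N q.
Proof.
rewrite /chi (@limn_series1 _ _ 0) ?expr0 ?mul1r // => m m0.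
by rewrite expr0n (negbTE m0) mul0r.
Qed.

Lemma least_period1 (q : circle R) : \val q = 1 -> least_period 1 q.
Proof.
move=> q1; split=> //; first by apply: circle_inj; rewrite /= q1 expr1n.
by case=> [|j] //; rewrite andbC.
Qed.

Lemma chi0_irreducible (q : circle R) :
  irreducible_rep AA (fun a => (chi 0 q a)%:M : 'M[R[i]]_1).
Proof.
split.
- split=> [a b aa ab|c a aa|a b aa ab]; rewrite !chi0E.
  + by rewrite fseriesDE raddfD.
  + by rewrite scale_scalar_mx.
  + rewrite -scalar_mxM /smul big_ord1 subnn; congr (_%:M); congr (a 0%N _ * _).
    by apply: circle_inj; rewrite /= expr1.
- exists (sone R); first exact: (alg_sone nbP).
  rewrite chi0E /sone /monomial /= => /matrixP/(_ 0 0).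
  by rewrite !mxE eqxx => /eqP; rewrite oner_eq0.
move=> U _; have [->|U0] := eqVneq U 0; [by left | right].
by rewrite /row_full eqn_leq rank_leq_col lt0n mxrank_eq0.
Qed.

Lemma listed_irreducible n (rho : fseries R -> 'M[R[i]]_n) :
  listed_rep rho -> irreducible_rep AA rho.
Proof.
case=> [p q [[q1 p1]|->]|k alpha gamma].
- by rewrite (chi1_pi p q1); apply: pi_irreducible p1; exact: least_period1.
- exact: chi0_irreducible.
- exact: pi_irreducible.
Qed.

End Norm.
End PiIrreducible.

(** * The listed representations separate points *)

Section Separation.
Variable R : realType.
Local Notation nc := (@Normc.normc R).
Local Notation cfun := (circle R -> R[i]).
Implicit Types (phi psi : cfun) (a b : fseries R) (z q alpha : circle R).

Lemma expi_surj z : exists2 t : R, 0 <= t & z = expi t.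
Proof.
have z1 := normc_circle z; case E : (\val z) z1 => [x y] /= z1.
have {}z1 : x ^+ 2 + y ^+ 2 = 1.
  by rewrite -[LHS]sqr_sqrtr ?z1 ?expr1n // addr_ge0 // sqr_ge0.
have x1 : -1 <= x <= 1.
  by rewrite -ler_norml -(@ler_pXn2r _ 2) ?nnegrE // expr1n real_normK ?num_real // -z1
    lerDl sqr_ge0.
have sx : sin (acos x) = `|y|.
  by rewrite sin_acos // -z1 addrC addKr sqrtr_sqr.
have cx : cos (acos x) = x by rewrite acosK // in_itv.
have [y0|y0] := leP 0 y.
  exists (acos x); first exact: acos_ge0.
  by apply: circle_inj; rewrite E val_expi cx sx ger0_norm.
exists (pi *+ 2 - acos x).
  rewrite subr_ge0; apply: le_trans (acos_lepi x1) _.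
  by rewrite mulr2n lerDl pi_ge0.
apply: circle_inj; rewrite E val_expi addrC cosD2pi sinD2pi cosN sinN cx sx.
by rewrite ltr0_norm // opprK.
Qed.

Lemma cpow_expi (t : R) n : cpow (expi t) n = expi (n%:R * t).
Proof. by apply: circle_inj; rewrite [LHS](expi_exprz t n). Qed.

Lemma expi_2pi (t : R) n : expi (t + pi *+ 2 *+ n) = expi t.
Proof.
apply: circle_inj; rewrite !val_expi.
elim: n => [|n IH]; first by rewrite addr0.
by rewrite mulrSr addrA cosD2pi sinD2pi IH.
Qed.

(** The points of the circle periodic under squaring are dense: they include the
    (2 ^ k - 1)-th roots of unity. *)
Lemma periodic_dense q (d : R) : 0 < d ->
  exists alpha k, [/\ (0 < k)%N, cpow alpha (2 ^ k) = alpha & nc (\val alpha - \val q) < d].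
Proof.
move=> d0; have [t t0 ->] := expi_surj q.
have d20 : 0 < d / 2 by rewrite divr_gt0.
have /cvgrPdist_lt/(_ _ d20)/nbhs_ballP[e1 /= e10 h1] := @continuous_cos R t.
have /cvgrPdist_lt/(_ _ d20)/nbhs_ballP[e2 /= e20 h2] := @continuous_sin R t.
pose e := Num.min e1 e2.
have e0 : 0 < e by rewrite lt_min e10 e20.
have p0 : 0 < pi *+ 2 :> R by rewrite pmulrn_lgt0 // pi_gt0.
(* N exceeds 2 pi / e, and s is the multiple of 2 pi / N just below t *)
pose k := (Num.bound (pi *+ 2 / e)).+1; pose N := (2 ^ k - 1)%N.
have Nk : pi *+ 2 / e < N%:R.
  apply: (@lt_le_trans _ _ (Num.bound (pi *+ 2 / e))%:R).
    by apply: archi_boundP; rewrite divr_ge0 // ltW.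
  rewrite ler_nat /N /k; have := ltn_expl (Num.bound (pi *+ 2 / e)).+1 (isT : (1 < 2)%N).
  lia.
have N0 : 0 < N%:R :> R by apply: le_lt_trans Nk; rewrite divr_ge0 // ltW.
pose x : R := t * N%:R / (pi *+ 2).
have x0 : 0 <= x by rewrite divr_ge0 ?mulr_ge0 // ltW.
pose l := Num.truncn x.
have /andP[lx xl] : l%:R <= x < l.+1%:R by exact: truncn_itv.
pose s : R := l%:R * (pi *+ 2) / N%:R.
have ts : `|t - s| < e.
  have -> : t - s = (x - l%:R) * (pi *+ 2 / N%:R).
    have Nn0 : N%:R != 0 :> R by rewrite gt_eqF.
    have pn0 : pi *+ 2 != 0 :> R by rewrite gt_eqF.
    by rewrite /x /s; move: (N%:R : R) Nn0 (l%:R : R) (pi *+ 2 : R) pn0 => n n0 y p pn0;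
      field; rewrite pn0 n0.
  rewrite normrM (ger0_norm (_ : 0 <= pi *+ 2 / N%:R)) ?divr_ge0 ?(ltW p0) ?(ltW N0) //.
  have lt1 : `|x - l%:R| <= 1.
    rewrite ger0_norm ?subr_ge0 // lerBlDl; move: (ltW xl); by rewrite -natr1.
  apply: le_lt_trans (_ : pi *+ 2 / N%:R < e).
    by rewrite -[leRHS]mul1r ler_wpM2r // divr_ge0 // ltW.
  by rewrite ltr_pdivrMr // mulrC -ltr_pdivrMr.
exists (expi s), k; split=> //.
  rewrite cpow_expi.
  have -> : (2 ^ k)%:R * s = s + pi *+ 2 *+ l.
    have -> : (2 ^ k)%:R = 1 + N%:R :> R.
      by rewrite nat1r /N subn1 prednK ?expn_gt0.
    rewrite mulrDl mul1r; congr (_ + _).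
    by rewrite /s mulrC divfK ?gt_eqF // mulr_natl.
  exact: expi_2pi.
apply: le_lt_trans (normc_le_ReIm _) _; rewrite !val_expi /= (splitr d).
move: ts; rewrite /e lt_min => /andP[ts1 ts2].
by rewrite distrC [X in _ + X]distrC; apply: ltrD; [exact: h1 | exact: h2].
Qed.

(** Identity theorem: the first nonvanishing coefficient would be at most t * M
    in modulus for every t in ]0, 1]. *)
Lemma power_series_zero (u : nat -> R[i]) (M : R) :
  (forall N, \sum_(m < N) nc (u m) <= M) ->
  (forall g : R[i], 0 < nc g <= 1 -> sums (fun m => g ^+ m * u m) 0) ->
  forall m, u m = 0.
Proof.
move=> uM su; elim/ltn_ind => m IH.
apply: Normc.eq0_normc; apply/eqP; rewrite eq_le normc_ge0 andbT.
have M0 : 0 <= M by have := uM 0%N; rewrite big_ord0.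
apply/ler_addgt0Pr => e e0; rewrite add0r.
pose t : R := Num.min 1 (e / (M + 1)).
have M1 : 0 < M + 1 by rewrite ltr_wpDl.
have t0 : 0 < t by rewrite lt_min ltr01 divr_gt0.
have t1 : t <= 1 by rewrite ge_min lexx.
have tM : t * M <= e.
  apply: (@le_trans _ _ (t * (M + 1))); first by rewrite ler_wpM2l ?(ltW t0) // lerDl.
  by rewrite -ler_pdivlMr // ge_min lexx orbT.
have nct : nc t%:C = t by rewrite normc_real gtr0_norm.
have tn0 : t%:C != 0 :> R[i] by apply/eqP => h; move: t0; rewrite -nct h Normc.normc0 ltxx.
have := su t%:C; rewrite nct t0 t1 => /(_ isT) s0.
have s1 := sums_shift m.+1 s0.
have s2 := sumsZ (t%:C ^+ m)^-1 s1.
rewrite sub0r big_ord_recr /= big1 ?add0r in s2; last by move=> i _; rewrite IH ?mulr0.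
rewrite mulrN mulKf ?expf_neq0 // in s2.
rewrite -normcNE; apply: le_trans tM; apply: sums_normc_le s2 => N.
apply: (@le_trans _ _ (\sum_(k < N) t * nc (u (m.+1 + k)%N))).
  apply: ler_sum => k _; rewrite addSnnS exprD mulrA mulKf ?expf_neq0 //.
  rewrite Normc.normcM normcX nct ler_wpM2r ?normc_ge0 // exprS.
  by rewrite ler_piMr ?(ltW t0) // exprn_ile1 // ltW.
rewrite -mulr_sumr ler_wpM2l ?(ltW t0) //.
apply: le_trans (uM (m.+1 + N)%N); rewrite big_split_ord /= lerDr.
by apply: sumr_ge0 => k _; exact: normc_ge0.
Qed.

Section Norm.
Variables (nb : cfun -> R -> Prop) (nbP : coef_norm nb).
Local Notation AA := (nb_alg nb).

Lemma separation a : AA a -> a <> 0 ->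
  exists (n : nat) (rho : fseries R -> 'M[R[i]]_n), listed_rep rho /\ rho a <> 0.
Proof.
move=> aa a0; apply: contrapT => h; apply: a0.
have pi0 k alpha gamma : least_period k alpha -> 0 < nc gamma <= 1 ->
    pi_rep k alpha gamma a = 0.
  move=> la g1; apply: contrapT => ne; apply: h.
  exists k, (pi_rep k alpha gamma); split=> //.
  by apply: listed_pi => //; rewrite normc_norm ltcR lecR.
have per0 k alpha m : least_period k alpha -> a m alpha = 0.
  move=> la; have [k0 ak _] := la.
  pose i : 'I_k := Ordinal (ltn_pmod m k0); pose j : 'I_k := Ordinal k0.
  have [c ca [M cM]] := aa.
  pose u n := (i == (j + n) %% k :> nat)%N%:R * a n (cpow alpha (2 ^ j)).
  have uM N : \sum_(n < N) nc (u n) <= M.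
    apply: le_trans (cM N); apply: ler_sum => n _.
    rewrite /u; case: eqP => _; rewrite ?mul1r ?mul0r.
      exact: (nb_ev nbP (ca n)).
    by rewrite Normc.normc0; exact: (nb_ge0 nbP (ca n)).
  have su (g : R[i]) : 0 < nc g <= 1 -> sums (fun n => g ^+ n * u n) 0.
    move=> g1; have /andP[g0 g1'] := g1.
    have := @pi_sums _ _ nbP k alpha g g1' a i j aa; rewrite (pi0 _ _ _ la g1) mxE; congr
      sums.
    by apply/funext => n; rewrite pi_termE.
  have := power_series_zero uM su m; rewrite /u /= add0n eqxx mul1r expn0.
  by rewrite (_ : cpow alpha 1 = alpha) //; apply: circle_inj; rewrite /= expr1.
apply/funext => m; apply/funext => q; apply: contrapT => /eqP amq.
have [c ca] := alg_coef m aa.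
have amq0 : 0 < nc (a m q).
  rewrite lt_neqAle normc_ge0 andbT eq_sym; apply: contra amq => /eqP h0.
  by apply/eqP/Normc.eq0_normc.
have [d d0 dP] := nb_ccont nbP ca q amq0.
have [alpha [k [k0 ak aq]]] := periodic_dense q d0.
have [j lj] := least_period_exists k0 ak.
by have := dP _ aq; rewrite (per0 _ _ m lj) sub0r normcNE ltxx.
Qed.

End Norm.
End Separation.

(** * Classification of the irreducible representations *)

Section LinearAlgebra.
Variable F : fieldType.

(** Every linear subspace of the row vectors, given as a predicate, is the row
    space of a matrix. *)
Lemma subspace_mx n (P : 'rV[F]_n -> Prop) :
  P 0 -> (forall c u v, P u -> P v -> P (c *: u + v)) ->
  exists U : 'M[F]_n, forall v, P v <-> (v <= U)%MS.
Proof.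
move=> P0 Plin.
pose Q r := `[< exists U : 'M[F]_n, \rank U = r /\ forall v : 'rV_n, (v <= U)%MS -> P v >].
have exQ : exists r, Q r.
  by exists 0%N; apply/asboolP; exists 0; rewrite mxrank0; split=> // v /submx0null ->.
have Qn r : Q r -> (r <= n)%N by move=> /asboolP[U [<- _]]; exact: rank_leq_col.
case: (ex_maxnP exQ Qn) => r /asboolP[U [rU UP]] rmax; exists U => v; split; last exact: UP.
move=> Pv; have /rmax : Q (\rank (U + v)%MS).
  apply/asboolP; exists (U + v)%MS; split=> // w /sub_addsmxP[[w1 w2] /= ->].
  have /sub_rVP[c ->] : (w2 *m v <= v)%MS by exact: submxMl.
  by rewrite addrC; apply: Plin => //; apply: UP; exact: submxMl.
rewrite -rU => rle; apply: (submx_trans (addsmxSr U v)).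
by rewrite -(geq_leqif (mxrank_leqif_sup (addsmxSl U v))).
Qed.

End LinearAlgebra.

Section Classification.
Variable R : realType.
Local Notation nc := (@Normc.normc R).
Local Notation cfun := (circle R -> R[i]).
Implicit Types (phi psi : cfun) (a b : fseries R) (z q alpha : circle R).

Lemma irreducible_full (AA : set (fseries R)) n (rho : fseries R -> 'M[R[i]]_n) m
    (U : 'M[R[i]]_(m, n)) :
  irreducible_rep AA rho -> (forall a, AA a -> (U *m rho a <= U)%MS) -> U != 0 ->
  row_full U.
Proof.
move=> [_ _ irr] stU U0; have [a aa|h|] := irr <<U>>%MS.
- by rewrite (eqmxMr _ (genmxE U)) genmxE; exact: stU.
- by move/eqP: U0; case; apply/eqP; rewrite -submx0 -(genmxE U) h sub0mx.
by rewrite -!sub1mx genmxE.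
Qed.

(** An injective and surjective intertwiner is an equivalence; in particular the
    dimensions agree. *)
Lemma equivalent_intertwiner (AA : set (fseries R)) n k (rho : fseries R -> 'M[R[i]]_n)
    (rho' : fseries R -> 'M[R[i]]_k) (T : 'M[R[i]]_(k, n)) :
  listed_rep rho' -> row_free T -> row_full T ->
  (forall a, AA a -> T *m rho a = rho' a *m T) ->
  exists2 rho'' : fseries R -> 'M[R[i]]_n, listed_rep rho'' & equivalent_rep AA rho rho''.
Proof.
move=> lrho /eqP rT /eqP; rewrite rT => kn; move: rT; subst k => rT TT.
by exists rho' => //; exists T => //; rewrite -row_free_unit /row_free rT.
Qed.

Section Rep.
Variables (nb : cfun -> R -> Prop) (nbP : coef_norm nb).
Local Notation AA := (nb_alg nb).
Variables (n : nat) (rho : fseries R -> 'M[R[i]]_n).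
Hypothesis irr : irreducible_rep AA rho.

Let rhoD a b : AA a -> AA b -> rho (a + b) = rho a + rho b.
Proof. by case: irr => -[h _ _] _ _; exact: h. Qed.
Let rhoZ (c : R[i]) a : AA a -> rho (c *: a) = c *: rho a.
Proof. by case: irr => -[_ h _] _ _; exact: h. Qed.
Let rhoM a b : AA a -> AA b -> rho (smul a b) = rho a *m rho b.
Proof. by case: irr => -[_ _ h] _ _; exact: h. Qed.

Let rho0 : rho 0 = 0.
Proof. by rewrite -(scale0r (0 : fseries R)) (rhoZ 0 (alg0 nbP)) scale0r. Qed.

Let rho_sum (I : Type) (r : seq I) (G : I -> fseries R) :
  (forall i, AA (G i)) -> rho (\sum_(i <- r) G i) = \sum_(i <- r) rho (G i).
Proof.
move=> h; elim: r => [|x r IH]; first by rewrite !big_nil rho0.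
by rewrite !big_cons (rhoD (h x) (alg_sum nbP _ (fun i _ => h i))) IH.
Qed.

Lemma rho_one : rho (sone R) = 1%:M.
Proof.
have a1 := alg_sone nbP; set E := rho (sone R).
have El a : AA a -> E *m rho a = rho a by move=> aa; rewrite -rhoM // smul1l.
have Er a : AA a -> rho a *m E = rho a by move=> aa; rewrite -rhoM // smul1r.
have E0 : E != 0.
  by apply/eqP => E0; case: irr => _ [a aa ra] _; apply: ra; rewrite -El // E0 mul0mx.
have : row_full E.
  by apply: (irreducible_full irr) => // a aa; rewrite El // -(Er a aa); exact: submxMl.
rewrite row_full_unit => uE.
have EE : E *m E = E := El _ a1.
by rewrite -[LHS]mulmx1 -(mulmxV uE) mulmxA EE.
Qed.

(** The substitute for continuity of rho: no nonzero vector is fixed by an element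
    of norm less than 1, since its difference with the unit has a right inverse. *)
Lemma neumann_fixed a r (v : 'rV[R[i]]_n) :
  sbound nb a r -> r < 1 -> v *m rho a = v -> v = 0.
Proof.
move=> ar r1 va; have [b ab bE] := neumann nbP ar r1.
have aa := sbound_alg ar.
have := congr1 (fun M => v *m M) (congr1 rho bE).
rewrite /= (rhoD (alg_sone nbP) (algM nbP aa ab)) (rhoM aa ab) rho_one.
rewrite mulmxDr mulmx1 mulmxA va => /eqP.
by rewrite -subr_eq subrr eq_sym => /eqP.
Qed.

(** In an irreducible representation every nonzero vector is cyclic. *)
Lemma cyclic_vector (w u : 'rV[R[i]]_n) : w != 0 -> exists2 b, AA b & w *m rho b = u.
Proof.
move=> w0; pose P v := exists2 b, AA b & w *m rho b = v.
have [U UP] : exists U : 'M[R[i]]_n, forall v, P v <-> (v <= U)%MS.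
  apply: subspace_mx => [|c v v' [b ab <-] [b' ab' <-]].
    by exists 0; [exact: (alg0 nbP) | rewrite rho0 mulmx0].
  exists (c *: b + b'); first exact: (algD nbP (algZ nbP c ab) ab').
  by rewrite (rhoD (algZ nbP c ab) ab') (rhoZ c ab) mulmxDr scalemxAr.
have : row_full U.
  apply: (irreducible_full irr) => [a aa|].
    apply/row_subP => i; rewrite row_mul; apply/UP.
    have [b ab bE] : P (row i U) by apply/UP; exact: row_sub.
    by exists (smul b a); [exact: (algM nbP ab aa) | rewrite (rhoM ab aa) mulmxA bE].
  apply: contra w0 => /eqP U0; rewrite -submx0 -U0; apply/UP.
  by exists (sone R); [exact: (alg_sone nbP) | rewrite rho_one mulmx1].
by move=> fU; apply/UP; exact: submx_full.
Qed.

Let mono_alg m phi (c : R) : nb phi c -> AA (monomial m phi).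
Proof. by move=> pc; exact: (alg_monomial nbP m pc). Qed.

Let X := rho (gen_x R).

Lemma monomial_succ m phi : monomial m.+1 phi = smul (gen_x R) (monomial m phi).
Proof.
by rewrite /gen_x smul_monomial; congr monomial; apply/funext => z; rewrite mul1r.
Qed.

Lemma rho_monomial m phi (c : R) : nb phi c ->
  rho (monomial m phi) = X ^+ m *m rho (monomial 0 phi).
Proof.
move=> pc; elim: m => [|m IH]; first by rewrite expr0 mul1mx.
by rewrite monomial_succ (rhoM (alg_x nbP) (mono_alg m pc)) IH mulmxA exprS.
Qed.

Lemma rho_xpow m : rho (monomial m (fun=> 1)) = X ^+ m.
Proof. by rewrite (rho_monomial m (nb1 nbP)) rho_one mulmx1. Qed.

Lemma rho_commX phi (c : R) : nb phi c ->
  rho (monomial 0 phi) *m X = X *m rho (monomial 0 (fun z => phi (cpow z 2))).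
Proof.
move=> pc; have pc2 := nb_cpow nbP 2 pc.
rewrite /X -(rhoM (mono_alg 0 pc) (alg_x nbP)) -(rhoM (alg_x nbP) (mono_alg 0 pc2)).
congr rho; rewrite /gen_x !smul_monomial; congr monomial; apply/funext => z.
by rewrite mulr1 mul1r.
Qed.

Lemma rho_split a : AA a -> exists2 c : R, nb (a 0%N) c &
  rho a = rho (monomial 0 (a 0%N)) + X *m rho (sshift a).
Proof.
move=> aa; have [c ca] := alg_coef 0 aa; exists c => //.
have as' := alg_sshift nbP aa.
by rewrite {1}(series_split a) (rhoD (mono_alg 0 ca) (algM nbP (alg_x nbP) as')) (rhoM
  (alg_x nbP) as').
Qed.

(** The kernel of x is invariant, thanks to rho_commX for the coefficients and to
    rho_split for the other terms of a series. *)
Lemma rho_x_dichotomy : X = 0 \/ X \in unitmx.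
Proof.
have [K0|K0] := eqVneq (kermx X) 0.
  by right; rewrite -row_free_unit -kermx_eq0 K0.
left; have : row_full (kermx X).
  apply: (irreducible_full irr) => // a /rho_split[c ca ->].
  rewrite mulmxDr mulmxA mulmx_ker mul0mx addr0.
  by apply/sub_kermxP; rewrite -mulmxA (rho_commX ca) mulmxA mulmx_ker mul0mx.
by rewrite -sub1mx => /sub_kermxP; rewrite mul1mx.
Qed.

Lemma rep_dim_gt0 : (0 < n)%N.
Proof.
rewrite lt0n; apply/eqP => n0; case: irr => _ [a _ ra] _; apply: ra.
by apply/matrixP => i; have := ltn_ord i; rewrite {2}n0.
Qed.

(** The row vector v is a common eigenvector of the coefficient algebra, which acts
    on it by evaluation at the point q; v may be 0, so that these vectors form a
    subspace. *)
Definition joint_eigen q (v : 'rV[R[i]]_n) : Prop :=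
  forall phi c, nb phi c -> v *m rho (monomial 0 phi) = phi q *: v.

Lemma monomialD m phi psi :
  monomial m (fun z => phi z + psi z) = monomial m phi + monomial m psi.
Proof.
apply/funext => p; apply/funext => z; rewrite fseriesDE /monomial.
by case: eqP => _; rewrite ?addr0.
Qed.

Lemma monomialZ m (c : R[i]) phi :
  monomial m (fun z => c * phi z) = c *: monomial m phi.
Proof.
apply/funext => p; apply/funext => z.
rewrite (_ : (c *: _) p z = c * monomial m phi p z) // /monomial.
by case: eqP => _; rewrite ?mulr0.
Qed.

Lemma smul_monomial0 phi psi :
  smul (monomial 0 phi) (monomial 0 psi) = monomial 0 (fun z => phi z * psi z).
Proof.
rewrite smul_monomial; congr monomial; apply/funext => z; congr (phi _ * _).
by apply: circle_inj; rewrite /= expr1.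
Qed.

(** The image of the coefficient algebra is a commutative space of matrices; a
    common eigenvector of a finite spanning family is one for the whole image. *)
Lemma common_eigenvector_coef : exists2 v : 'rV[R[i]]_n, v != 0 &
  forall phi c, nb phi c -> exists l : R[i], v *m rho (monomial 0 phi) = l *: v.
Proof.
pose Q (w : 'rV[R[i]]_(n * n)) :=
  exists2 phi, (exists c, nb phi c) & w = mxvec (rho (monomial 0 phi)).
have [U UP] : exists U : 'M[R[i]]_(n * n), forall w, Q w <-> (w <= U)%MS.
  apply: subspace_mx => [|c u w [phi [d pd] ->] [psi [e qe] ->]].
    exists (fun=> 0); first by exists 0; exact: (nb0 nbP).
    rewrite (_ : monomial 0 _ = 0) ?rho0 ?linear0 //.
    by apply/funext => p; apply/funext => z; rewrite /monomial; case: eqP.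
  exists (fun z => c * phi z + psi z).
    by exists (nc c * d + e); exact: (nbD nbP (nbZ nbP c pd) qe).
  rewrite monomialD monomialZ (rhoD (algZ nbP c (mono_alg 0 pd)) (mono_alg 0 qe)).
  by rewrite (rhoZ c (mono_alg 0 pd)) linearP.
have Arow i : exists2 phi, (exists c, nb phi c) & vec_mx (row i U) = rho (monomial 0 phi).
  have [phi [c pc] E] : Q (row i U) by apply/UP; exact: row_sub.
  by exists phi; [exists c | rewrite E mxvecK].
pose As := [seq vec_mx (row i U) | i <- enum 'I_(n * n)].
have comm : {in As &, forall A B : 'M[R[i]]_n, comm_mx A B}.
  move=> _ _ /mapP[i _ ->] /mapP[j _ ->].
  have [phi [c pc] ->] := Arow i; have [psi [d qd] ->] := Arow j.
  rewrite /comm_mx -(rhoM (mono_alg 0 pc) (mono_alg 0 qd)).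
  rewrite -(rhoM (mono_alg 0 qd) (mono_alg 0 pc)) !smul_monomial0.
  by congr (rho (monomial 0 _)); apply/funext => z; rewrite mulrC.
have [v v0 /allP vst] := common_eigenvector rep_dim_gt0 comm.
exists v => // phi c pc; apply/sub_rVP.
have /submxP[w wE] : (mxvec (rho (monomial 0 phi)) <= U)%MS.
  by apply/UP; exists phi => //; exists c.
rewrite -[rho _]mxvecK wE (mulmx_sum_row w) linear_sum mulmx_sumr summx_sub // => i _.
rewrite linearZ -scalemxAr scalemx_sub //; apply: vst.
by apply/mapP; exists i => //; rewrite mem_enum.
Qed.

Hypothesis char_point : forall lam q phi c,
  bounded_char nb lam q -> nb phi c -> lam phi = phi q.

(** The eigenvalue defines a character, bounded by neumann_fixed; its value on z
    has modulus 1 because both z and its inverse have norm 1. *)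
Lemma joint_eigen_exists : exists (q : circle R) (v : 'rV[R[i]]_n), v != 0 /\ joint_eigen
  q v.
Proof.
have [v v0 vE] := common_eigenvector_coef.
have [j vj] : exists j, v 0 j != 0.
  apply: contrapT => h; move/eqP: v0; apply; apply/rowP => j; rewrite [RHS]mxE.
  by apply/eqP; apply: contrapT => /negP vj; apply: h; exists j.
pose lam phi : R[i] := (v *m rho (monomial 0 phi)) 0 j / v 0 j.
have lamE phi c : nb phi c -> v *m rho (monomial 0 phi) = lam phi *: v.
  by move=> /vE[l h]; rewrite /lam h mxE mulfK.
have lam_eq phi (l : R[i]) : v *m rho (monomial 0 phi) = l *: v -> lam phi = l.
  by move=> h; rewrite /lam h mxE mulfK.
have lamM phi psi c d : nb phi c -> nb psi d -> lam (fun z => phi z * psi z) = lam phi *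
  lam psi.
  move=> pc qd; apply: lam_eq.
  rewrite -smul_monomial0 (rhoM (mono_alg 0 pc) (mono_alg 0 qd)) mulmxA (lamE _ _ pc).
  by rewrite -scalemxAl (lamE _ _ qd) scalerA.
have lam1 : lam (fun=> 1) = 1.
  by apply: lam_eq; rewrite [X in _ *m X]rho_one mulmx1 scale1r.
have lam_le phi c : nb phi c -> nc (lam phi) <= c.
  move=> pc; rewrite leNgt; apply/negP => clt.
  have c0 := nb_ge0 nbP pc; have l0 : 0 < nc (lam phi) by exact: le_lt_trans clt.
  have ln0 : lam phi != 0 by apply: contraTneq l0 => ->; rewrite Normc.normc0 ltxx.
  move/eqP: v0; apply; apply: (neumann_fixed (sboundZ nbP (lam phi)^-1 (sbound_monomial
    nbP 0 pc))).
    by rewrite Normc.normcV mulrC ltr_pdivrMr // mul1r.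
  by rewrite (rhoZ _ (mono_alg 0 pc)) -scalemxAr (lamE _ _ pc) scalerA mulVf // scale1r.
have valb := nb_val nbP; have valVb := nb_exprz nbP (-1).
have lamV : lam (fun z => \val z) * lam (fun z => \val z ^ (-1)) = 1.
  rewrite -(lamM _ _ _ _ valb valVb) -[RHS]lam1; congr lam; apply/funext => z.
  by rewrite exprN1 mulfV ?val_circle_neq0.
have q1 : nc (lam (fun z => \val z)) = 1.
  apply/eqP; rewrite eq_le (lam_le _ _ valb) /=.
  have := congr1 nc lamV; rewrite Normc.normcM Normc.normc1 => <-.
  by rewrite ler_piMr ?normc_ge0 // (lam_le _ _ valVb).
have qc : lam (fun z => \val z) \in circle R by apply/mem_set; rewrite /circle /=
  normc_norm q1.
pose q : circle R := exist (fun w => w \in circle R) _ qc.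
have lamP : bounded_char nb lam q.
  split=> //.
  - move=> phi psi c d pc qd; apply: lam_eq.
    by rewrite monomialD (rhoD (mono_alg 0 pc) (mono_alg 0 qd)) mulmxDr (lamE _ _ pc)
      (lamE _ _ qd) scalerDl.
  - move=> k phi c pc; apply: lam_eq.
    by rewrite monomialZ (rhoZ k (mono_alg 0 pc)) -scalemxAr (lamE _ _ pc) scalerA.
exists q, v; split=> // phi c pc.
by rewrite (lamE _ _ pc) (char_point lamP pc).
Qed.

(** If x acts as 0, the representation is a character with chi(x) = 0. *)
Lemma classification_x0 : X = 0 ->
  exists2 rho' : fseries R -> 'M[R[i]]_n, listed_rep rho' & equivalent_rep AA rho rho'.
Proof.
move=> X0; have [q [v [v0 vq]]] := joint_eigen_exists.
have va a : AA a -> v *m rho a = chi 0 q a *: v.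
  move=> /rho_split[c ca ->]; rewrite X0 mul0mx addr0 (vq _ _ ca).
  by rewrite chi0E.
have fv : row_full v.
  by apply: (irreducible_full irr) => // a aa; rewrite va // scalemx_sub.
apply: (equivalent_intertwiner (rho' := fun a => (chi 0 q a)%:M) (T := v)) => //.
- by apply: listed_chi; right.
- by rewrite -row_leq_rank lt0n mxrank_eq0.
- by move=> a aa; rewrite va // mul_scalar_mx.
Qed.

Section XUnit.
Hypothesis uX : X \in unitmx.
Let Xi := invmx X.

Lemma mulXi m : X ^+ m *m Xi ^+ m = 1%:M.
Proof.
elim: m => [|m IH]; first by rewrite !expr0 mulmx1.
by rewrite exprSr exprS mulmxA -(mulmxA _ X) mulmxV // mulmx1 IH.
Qed.

Lemma mulXiX m : Xi ^+ m *m X ^+ m = 1%:M.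
Proof. exact: mulmx1C (mulXi m). Qed.

(** The inverse of x sends the joint eigenspace of q to that of q^2. *)
Lemma joint_eigen_Xi q v : joint_eigen q v -> joint_eigen (cpow q 2) (v *m Xi).
Proof.
move=> vq phi c pc; rewrite -mulmxA.
have -> : Xi *m rho (monomial 0 phi) = rho (monomial 0 (fun z => phi (cpow z 2))) *m Xi.
  rewrite -[LHS]mulmx1 -(mulmxV uX) -/Xi mulmxA -(mulmxA Xi) (rho_commX pc).
  by rewrite mulmxA mulVmx // mul1mx.
by rewrite mulmxA (vq _ _ (nb_cpow nbP 2 pc)) scalemxAl.
Qed.

Lemma joint_eigen_Xi_exp q v m : joint_eigen q v ->
  joint_eigen (cpow q (2 ^ m)) (v *m Xi ^+ m).
Proof.
move=> vq; elim: m => [|m IH].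
  rewrite expr0 mulmx1 (_ : cpow q (2 ^ 0) = q) //.
  by apply: circle_inj; rewrite /= expr1.
rewrite exprSr mulmxA expnSr -cpowM; exact: joint_eigen_Xi.
Qed.

Lemma mul_Xi_exp_neq0 (v : 'rV[R[i]]_n) m : v != 0 -> v *m Xi ^+ m != 0.
Proof.
apply: contra => /eqP h; rewrite -(mulmx1 v) -(mulXiX m) mulmxA h mul0mx //.
Qed.

(** The orbit of a joint eigenvalue under squaring is finite, since its points are
    eigenvalues of y. *)
Lemma joint_eigen_repeat q (v : 'rV[R[i]]_n) : v != 0 -> joint_eigen q v ->
  exists i j, (i < j)%N /\ cpow q (2 ^ i) = cpow q (2 ^ j).
Proof.
move=> v0 vq; apply: contrapT => h.
pose ev m := \val (cpow q (2 ^ m)).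
have ev_inj : injective ev.
  move=> i j /circle_inj e; apply: contrapT => /eqP ij; apply: h.
  by move: ij; rewrite neq_ltn => /orP[ij|ij]; [exists i, j | exists j, i].
pose Y := rho (monomial 0 (fun z => \val z)).
have evY m : root (char_poly Y) (ev m).
  rewrite -eigenvalue_root_char; apply/eigenvalueP.
  exists (v *m Xi ^+ m); last exact: mul_Xi_exp_neq0.
  exact: (joint_eigen_Xi_exp m vq (nb_val nbP)).
pose s := [seq ev m | m <- iota 0 n.+1].
have rs : all (root (char_poly Y)) s by apply/allP => _ /mapP[m _ ->].
have us : uniq s by rewrite (map_inj_uniq ev_inj) iota_uniq.
have := max_poly_roots (monic_neq0 (char_poly_monic Y)) rs us.
by rewrite size_map size_iota size_char_poly ltnn.
Qed.

(** On the joint eigenspace of a point alpha of least period k, the inverse of x^k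
    acts and has an eigenvector; gamma is a k-th root of the eigenvalue of x^k. *)
Lemma periodic_eigenvector : exists alpha k (gamma : R[i]) (u : 'rV[R[i]]_n),
  [/\ least_period k alpha, gamma != 0, u != 0, joint_eigen alpha u &
      u *m X ^+ k = gamma ^+ k *: u].
Proof.
have [q [v [v0 vq]]] := joint_eigen_exists.
have [i [j [ij eij]]] := joint_eigen_repeat v0 vq.
pose alpha := cpow q (2 ^ i).
have [k la] : exists k, least_period k alpha.
  apply: (@least_period_exists _ alpha (j - i)); first by rewrite subn_gt0.
  by rewrite /alpha cpowM -expnD subnKC // ltnW.
have [k0 ak _] := la.
have [U UP] : exists U : 'M[R[i]]_n, forall w, joint_eigen alpha w <-> (w <= U)%MS.
  apply: subspace_mx => [phi c pc|c w w' hw hw' phi d pd]; first by rewrite mul0mx scaler0.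
  rewrite mulmxDl -scalemxAl (hw _ _ pd) (hw' _ _ pd) scalerDr !scalerA.
  by rewrite [c * _]mulrC.
have U0 : U != 0.
  apply: contra (mul_Xi_exp_neq0 i v0) => /eqP U0; rewrite -submx0 -U0.
  by apply/UP; exact: joint_eigen_Xi_exp.
(* the matrix of the action of the inverse of x^k on the joint eigenspace *)
pose V := row_base U; pose Z := V *m Xi ^+ k *m pinvmx V.
have VZ : V *m Xi ^+ k = Z *m V.
  rewrite /Z mulmxKpV //; apply/row_subP => r; rewrite row_mul.
  apply: (submx_trans _ (_ : (U <= V)%MS)); last by rewrite eq_row_base.
  apply/UP; rewrite -ak; apply: joint_eigen_Xi_exp; apply/UP.
  by apply: (submx_trans (row_sub r V)); rewrite eq_row_base.
have rU : (0 < \rank U)%N by rewrite lt0n mxrank_eq0.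
have comm : {in [:: Z] &, forall A B : 'M[R[i]]_(\rank U), comm_mx A B}.
  by move=> A B; rewrite !inE => /eqP -> /eqP ->.
have [w w0 /= /andP[/sub_rVP[mu wZ] _]] := common_eigenvector rU comm.
pose u := w *m V.
have u0 : u != 0.
  apply: contra w0 => /eqP uw; rewrite -(mulmx1 w).
  by have := row_base_free U => /row_freeP[B VB]; rewrite -VB mulmxA -/V -/u uw mul0mx.
have uXi : u *m Xi ^+ k = mu *: u by rewrite /u -mulmxA VZ mulmxA wZ scalemxAl.
have mu0 : mu != 0.
  apply: contra (mul_Xi_exp_neq0 k u0) => /eqP mu0.
  by rewrite uXi mu0 scale0r.
exists alpha, k, (k.-root mu^-1), u; split=> //.
- by rewrite rootC_eq0 // invr_eq0.
- apply/UP; apply: (submx_trans (submxMl _ _)); by rewrite eq_row_base.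
rewrite rootCK //.
have := congr1 (fun M => M *m X ^+ k) uXi.
rewrite /= -mulmxA mulXiX mulmx1 -scalemxAl => uE.
by rewrite [in RHS]uE scalerA mulVf // scale1r.
Qed.

(** If x is invertible, the representation is equivalent to pi_rep k alpha gamma,
    with the notations of periodic_eigenvector.  The vectors gamma^j u x^(-j) are the
    images of the basis vectors under an intertwiner T for monomials; the difficulty
    is to extend this to arbitrary series, as rho is not assumed to be continuous. *)
Lemma classification_unit :
  exists2 rho' : fseries R -> 'M[R[i]]_n, listed_rep rho' & equivalent_rep AA rho rho'.
Proof.
have [alpha [k [gamma [u [la g0 u0 ua uX']]]]] := periodic_eigenvector.
have [k0 ak _] := la.
(* Otherwise gamma^(-k) x^k has norm less than 1 and fixes u. *)
have g1 : nc gamma <= 1.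
  rewrite leNgt; apply/negP => g1; move/eqP: u0; apply.
  have gk : gamma ^+ k != 0 by rewrite expf_neq0.
  apply: (neumann_fixed (sboundZ nbP (gamma ^+ k)^-1 (sbound_monomial nbP k (nb1 nbP)))).
    rewrite mulr1 Normc.normcV normcX invf_lt1 ?exprn_gt0 ?(lt_trans ltr01) //.
    by rewrite exprn_egt1 // -lt0n.
  rewrite (rhoZ _ (mono_alg k (nb1 nbP))) rho_xpow -scalemxAr uX' scalerA mulVf //.
  by rewrite scale1r.
have gn : 0 < nc gamma by rewrite lt_neqAle normc_ge0 andbT eq_sym; apply: contra g0 =>
  /eqP/Normc.eq0_normc ->.
pose pi := pi_rep k alpha gamma.
have piI : irreducible_rep AA pi.
  by apply: (pi_irreducible nbP la); rewrite normc_norm ltcR lecR gn.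
pose T : 'M[R[i]]_(k, n) := \matrix_j (gamma ^+ j *: (u *m Xi ^+ j)).
have rowT j : row j T = gamma ^+ j *: (u *m Xi ^+ j) by rewrite rowK.
(* T intertwines x, then the coefficients, hence every monomial. *)
have TX : T *m X = (gamma *: shift_mx R k) *m T.
  apply/row_matrixP => i; rewrite !row_mul rowT.
  (* the cyclic predecessor of i *)
  pose l : 'I_k := Ordinal (ltn_pmod (i + k.-1) k0).
  have il : (i = l.+1 %% k :> nat)%N.
    by rewrite /= -addn1 modnDml -addnA addn1 prednK // modnDr modn_small.
  have -> : row i (gamma *: shift_mx R k) = gamma *: delta_mx 0 l.
    apply/rowP => j; rewrite mxE [LHS]mxE [RHS]mxE shift_mxE mxE eqxx /=; congr (_ * _%:R).
    rewrite {1}il -(addn1 l) -(addn1 j) eqn_modDr !modn_small //.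
    by rewrite eq_sym.
  rewrite -!scalemxAl -rowE rowT scalerA -exprS -mulmxA.
  have XiX m : Xi ^+ m.+1 *m X = Xi ^+ m.
    by rewrite exprSr -mulmxA mulVmx // mulmx1.
  have [lk|lk] := ltnP l.+1 k.
    by rewrite il modn_small // XiX.
  have {}lk : l.+1 = k by apply/eqP; rewrite eqn_leq lk ltn_ord.
  have i0 : i = 0%N :> nat by rewrite il lk modnn.
  rewrite i0 lk !expr0 scale1r mul1mx scalemxAl -uX' -mulmxA; congr (_ *m _).
  by rewrite -{1}lk exprS -mulmxA mulXi mulmx1.
have TXm m : T *m X ^+ m = (gamma ^+ m *: shift_mx R k ^+ m) *m T.
  elim: m => [|m IH]; first by rewrite !expr0 scale1r mulmx1 mul1mx.
  have SS : shift_mx R k ^+ m.+1 = shift_mx R k ^+ m *m shift_mx R k by exact: exprSr.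
  have XX : X ^+ m.+1 = X ^+ m *m X by exact: exprSr.
  rewrite XX mulmxA IH -mulmxA TX mulmxA SS exprSr; congr (_ *m T).
  by rewrite -scalemxAl -scalemxAr scalerA.
have Tphi phi c : nb phi c -> T *m rho (monomial 0 phi) = diag_of k alpha phi *m T.
  move=> pc; apply/row_matrixP => i; rewrite !row_mul rowT -scalemxAl.
  rewrite (joint_eigen_Xi_exp i ua pc).
  have -> : row i (diag_of k alpha phi) = phi (cpow alpha (2 ^ i)) *: delta_mx 0 i.
    apply/rowP => j; rewrite /diag_of !mxE eqxx /=.
    by have [->|ij] := eqVneq i j; rewrite ?mulr1 ?mulr0.
  by rewrite -scalemxAl -rowE rowT scalerA mulrC -scalerA.
have Tmono m phi c : nb phi c -> T *m rho (monomial m phi) = pi (monomial m phi) *m T.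
  move=> pc; rewrite (rho_monomial m pc) mulmxA TXm -mulmxA (Tphi _ _ pc) mulmxA.
  by rewrite /pi pi_rep_monomial scalemxAl.
have piA a b : AA a -> AA b -> pi (a + b) = pi a + pi b := piD nbP k alpha g1 (a:=a) (b:=b).
have piS (c : R[i]) a : AA a -> pi (c *: a) = c *: pi a := piZ nbP k alpha g1 c (a:=a).
have piP a b : AA a -> AA b -> pi (smul a b) = pi a *m pi b := piM nbP ak g1 (a:=a) (b:=b).
have piSum (I : Type) (r : seq I) (G : I -> fseries R) :
    (forall i, AA (G i)) -> pi (\sum_(i <- r) G i) = \sum_(i <- r) pi (G i).
  exact: (pi_sum nbP k alpha g1).
have Ttrunc P a : AA a -> T *m rho (strunc P a) = pi (strunc P a) *m T.
  move=> aa; have am (m : 'I_P) : AA (monomial m (a m)).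
    by have [c ca] := alg_coef m aa; exact: mono_alg ca.
  rewrite /strunc (rho_sum _ am) (piSum _ _ _ am) mulmx_sumr mulmx_suml.
  by apply: eq_bigr => m _; have [c ca] := alg_coef m aa; exact: Tmono ca.
(* pi (g l) sends the first basis vector to the l-th: x lowers the index by one
   cyclically, and 0 = l + (k - l) modulo k. *)
pose o : 'I_k := Ordinal k0; pose e0 : 'rV[R[i]]_k := delta_mx 0 o.
pose w (l : 'I_k) := (gamma ^+ (k - l))^-1.
pose g (l : 'I_k) : fseries R := w l *: monomial (k - l) (fun=> 1).
have gA l : AA (g l) := algZ nbP (w l) (mono_alg (k - l) (nb1 nbP)).
have pig l : e0 *m pi (g l) = delta_mx 0 l.
  rewrite (piS _ _ (mono_alg _ (nb1 nbP))) /pi pi_rep_monomial scalerA mulVf ?expf_neq0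
    // scale1r.
  rewrite -rowE; apply/rowP => j; rewrite mxE diag_ofE mulr1 shift_mxXE [RHS]mxE eqxx /=.
  congr (_%:R); have lk : (l <= k)%N by exact: ltnW.
  have -> : (0 == (j + (k - l)) %% k)%N = (l + (k - l) == j + (k - l) %[mod k]).
    by rewrite subnKC // modnn.
  by rewrite eqn_modDr !modn_small // eq_sym.
have Tg l : T *m rho (g l) = pi (g l) *m T.
  have ma := mono_alg (k - l) (nb1 nbP).
  by rewrite (rhoZ _ ma) (piS _ _ ma) -scalemxAr (Tmono _ _ _ (nb1 nbP)) scalemxAl.
have e0T : e0 *m T = u by rewrite -rowE rowT expr0 scale1r expr0 mulmx1.
(* a polynomial in x sending e0 to a prescribed vector, of norm at most G times
   the largest modulus of an entry *)
pose sel (x : 'rV[R[i]]_k) : fseries R := \sum_l x 0 l *: g l.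
have selA x : AA (sel x) by apply: (alg_sum nbP) => l _; exact: (algZ nbP _ (gA l)).
have pisel x : e0 *m pi (sel x) = x.
  have xg l : AA (x 0 l *: g l) := algZ nbP (x 0 l) (gA l).
  rewrite (piSum _ _ _ xg) mulmx_sumr [RHS]row_sum_delta.
  by apply: eq_bigr => l _; rewrite (piS _ _ (gA l)) -scalemxAr pig.
have Tsel x : T *m rho (sel x) = pi (sel x) *m T.
  have xg l : AA (x 0 l *: g l) := algZ nbP (x 0 l) (gA l).
  rewrite (piSum _ _ _ xg) (rho_sum _ xg) mulmx_sumr mulmx_suml; apply: eq_bigr => l _.
  by rewrite (rhoZ _ (gA l)) (piS _ _ (gA l)) -scalemxAr Tg scalemxAl.
pose G := \sum_l nc (w l).
have G0 : 0 <= G by apply: sumr_ge0 => l _; exact: normc_ge0.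
have sel_bound (x : 'rV[R[i]]_k) (d : R) : (forall l, nc (x 0 l) <= d) -> sbound nb (sel
  x) (d * G).
  move=> xd.
  have : sbound nb (sel x) (\sum_l nc (x 0 l) * (nc (w l) * 1)).
    rewrite /sel; elim/big_rec2: _ => [|l r s _ rs]; first exact: (sbound0 nbP).
    apply: (sboundD nbP _ rs); do 2!apply: (sboundZ nbP).
    exact: (sbound_monomial nbP _ (nb1 nbP)).
  move/(sbound_le); apply; rewrite /G mulr_sumr; apply: ler_sum => l _.
  by rewrite mulr1 ler_wpM2r ?normc_ge0.
(* This is where the absence of continuity is overcome.  If a kills e0 but
   not u, some c = smul a b kills e0 and fixes u.  Truncate c = p + r with r
   small, and replace p by the element s of the span of the g l acting on e0 as
   p does; s is small because e0 *m pi p = - e0 *m pi r.  On u, p and s act alike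
   since both are polynomials in x, so r + s, of norm less than 1, fixes u. *)
have key a : AA a -> e0 *m pi a = 0 -> u *m rho a = 0.
  move=> aa ea; apply/eqP; apply: contraT => /(cyclic_vector u)[b ab ub].
  move/eqP: u0; case.
  have cA := algM nbP aa ab; set c := smul a b in cA.
  have uc : u *m rho c = u by rewrite /c (rhoM aa ab) mulmxA.
  have ec : e0 *m pi c = 0 by rewrite /c (piP _ _ aa ab) mulmxA ea mul0mx.
  pose d := (2 * (1 + G))^-1.
  have G1 : 0 < 1 + G by rewrite ltr_wpDr.
  have d0 : 0 < d by rewrite invr_gt0 mulr_gt0.
  have [P cP] := strunc_approx nbP cA d0.
  have rA := sbound_alg cP; set r := c - strunc P c in cP rA.
  have pA := alg_strunc nbP P cA.
  have cE : c = strunc P c + r by rewrite addrC subrK.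
  pose x := e0 *m pi (strunc P c).
  have xr : x = - (e0 *m pi r).
    by apply/eqP; rewrite -addr_eq0 -mulmxDr -(piA _ _ pA rA) -cE ec.
  have xd l : nc (x 0 l) <= d.
    rewrite xr mxE normcNE -rowE mxE; exact: (pi_le nbP alpha g1 o l cP).
  have sb := sel_bound x d xd.
  have ur : u *m rho (r + sel x) = u.
    rewrite (rhoD rA (selA x)) mulmxDr -{2}e0T -(mulmxA e0) Tsel mulmxA pisel.
    rewrite /x -mulmxA -(Ttrunc _ _ cA) mulmxA e0T -mulmxDr -(rhoD rA pA).
    by rewrite addrC -cE.
  apply: (neumann_fixed (sboundD nbP cP sb) _ ur).
  have -> : d + d * G = 2^-1 by rewrite /d invfM; field; rewrite gt_eqF.
  by rewrite invf_lt1 // ltr1n.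
have key2 a : AA a -> u *m rho a = e0 *m pi a *m T.
  move=> aa; have [x xE] : exists x, e0 *m pi a = x by eexists.
  have sN := algZ nbP (-1) (selA x); have ha := algD nbP aa sN.
  have E1 : pi (a + (-1) *: sel x) = pi a + (-1) *: pi (sel x).
    by rewrite (piA _ _ aa sN) (piS _ _ (selA x)).
  have E2 : e0 *m pi (a + (-1) *: sel x) = 0.
    by rewrite E1 mulmxDr xE -(scalemxAr (-1) e0 (pi (sel x))) (pisel x) scaleN1r subrr.
  have E3 : rho (a + (-1) *: sel x) = rho a + (-1) *: rho (sel x).
    by rewrite (rhoD aa sN) (rhoZ _ (selA x)).
  have := key _ ha E2; rewrite E3 mulmxDr -scalemxAr scaleN1r => /eqP.
  rewrite subr_eq0 => /eqP ->.
  by rewrite xE -{1}e0T -(mulmxA e0) (Tsel x) mulmxA (pisel x).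
have Tall a : AA a -> T *m rho a = pi a *m T.
  move=> aa; apply/row_matrixP => l; rewrite !row_mul.
  have -> : row l T = u *m rho (g l) by rewrite -e0T -mulmxA Tg mulmxA pig -rowE.
  have gaA := algM nbP (gA l) aa.
  by rewrite -mulmxA -(rhoM (gA l) aa) (key2 _ gaA) (piP _ _ (gA l) aa) mulmxA pig -rowE.
have T0 : T != 0 by apply: contra u0 => /eqP T0; rewrite -e0T T0 mulmx0.
apply: (equivalent_intertwiner (rho' := pi) (T := T)) => //.
- by apply: listed_pi => //; rewrite normc_norm ltcR lecR gn.
- rewrite -kermx_eq0; apply: contraT => K0.
  have : row_full (kermx T).
    apply: (irreducible_full piI _ K0) => a aa; apply/sub_kermxP.
    by rewrite -mulmxA -Tall // mulmxA mulmx_ker mul0mx.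
  by rewrite -sub1mx => /sub_kermxP; rewrite mul1mx => /eqP; rewrite (negbTE T0).
- by apply: (irreducible_full irr) => // a aa; rewrite Tall // submxMl.
Qed.

End XUnit.

End Rep.
End Classification.

Lemma classification (R : realType) (nb : (circle R -> R[i]) -> R -> Prop) n
    (rho : fseries R -> 'M[R[i]]_n) : coef_norm nb ->
  (forall lam q phi c, bounded_char nb lam q -> nb phi c -> lam phi = phi q) ->
  irreducible_rep (nb_alg nb) rho ->
  exists2 rho' : fseries R -> 'M[R[i]]_n, listed_rep rho' &
    equivalent_rep (nb_alg nb) rho rho'.
Proof.
move=> nbP char_point irr; have [x0|ux] := rho_x_dichotomy nbP irr.
  exact: (classification_x0 nbP irr char_point x0).
exact: (classification_unit nbP irr char_point ux).
Qed.

Theorem theorem2p3 (R : realType) (AA : set (fseries R))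
    (AA_AB : AA = algA R \/ AA = algB R) :
  [/\ forall (n : nat) (rho : fseries R -> 'M[R[i]]_n),
        listed_rep rho -> irreducible_rep AA rho,
      forall (n : nat) (rho : fseries R -> 'M[R[i]]_n),
        irreducible_rep AA rho ->
        exists2 rho' : fseries R -> 'M[R[i]]_n,
          listed_rep rho' & equivalent_rep AA rho rho' &
      forall a : fseries R, AA a -> a <> 0 ->
        exists (n : nat) (rho : fseries R -> 'M[R[i]]_n),
          listed_rep rho /\ rho a <> 0].
Proof.
have [nb [nbP char_point ->]] : exists nb : (circle R -> R[i]) -> R -> Prop,
    [/\ coef_norm nb,
        forall lam q phi c, bounded_char nb lam q -> nb phi c -> lam phi = phi q &
        AA = nb_alg nb].
  case: AA_AB => ->.
    exists (@wiener_bound R); split; last exact: algA_nb_alg.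
      exact: wiener_bound_coef_norm.
    by move=> lam q phi c; exact: wiener_bound_char.
  exists (@sup_bound R); split; last exact: algB_nb_alg.
    exact: sup_bound_coef_norm.
  by move=> lam q phi c; exact: sup_bound_char.
split.
- by move=> n rho; exact: listed_irreducible.
- by move=> n rho; exact: classification.
- by move=> a; exact: separation.
Qed.
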